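(* Let $X$ be a completely regular topological space and $C(X)$ the ring of all continuous real functions on $X$. The completion, with respect to the metric $\rho$, of the maximal ring of quotients $\mathcal{Q}(C(X))$ of $C(X)$ is $\mathbb{H}_{nf}(X)$, that is, \[ \overline{\mathcal{Q}(C(X))}=\mathbb{H}_{nf}(X). \]
   Context: Notation: $\overline{\mathbb{R}}=\mathbb{R}\cup\{\pm\infty\}$ and $\mathbb{I}\overline{\mathbb{R}}=\{[\underline{a},\overline{a}]:\underline{a},\overline{a}\in\overline{\mathbb{R}},\ \underline{a}\le\overline{a}\}$; $a\in\overline{\mathbb{R}}$ is identified with $[a,a]$. The modulus of $a=[\underline{a},\overline{a}]$ is $|a|=\max\{|\underline{a}|,|\overline{a}|\}$. Its width is $w(a)=\overline{a}-\underline{a}$ if both endpoints are finite; $w(a)=+\infty$ if $\underline{a}<\overline{a}=+\infty$ or $\underline{a}=-\infty<\overline{a}$; $w(a)=0$ if $\underline{a}=\overline{a}=\pm\infty$. An interval function $f:X\to\mathbb{I}\overline{\mathbb{R}}$ is S-continuous if its graph $\{(x,y): x\in X,\ y\in f(x)\}$ is a closed subset of $X\times\overline{\mathbb{R}}$. For interval functions, $\varphi\subseteq f$ means $\varphi(x)\subseteq f(x)$ for all $x\in X$. An interval function $f$ is Hausdorff continuous (H-continuous) if it is S-continuous and minimal with respect to inclusion: whenever $\varphi:X\to\mathbb{I}\overline{\mathbb{R}}$ is S-continuous and $\varphi\subseteq f$, then $\varphi=f$. $\mathbb{H}(X)$ denotes the set of all H-continuous functions on $X$. For $f\in\mathbb{H}(X)$,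 $W_f=\{x\in X: w(f(x))>0\}$ and $\Gamma_f=\{x\in X: -\infty\in f(x)\text{ or }+\infty\in f(x)\}$; $f$ is nearly finite if $\Gamma_f$ is closed and nowhere dense in $X$. $\mathbb{H}_{nf}(X)$ is the set of all nearly finite H-continuous functions on $X$; it contains $C(X)$. Interval arithmetic: for $A,B\in\mathbb{I}\overline{\mathbb{R}}$, $A+B=\{a+b:a\in A,b\in B\}$ and $A\times B=\{ab:a\in A,b\in B\}$, with the ambiguities at infinity resolved so as to guarantee inclusion: $-\infty+(+\infty)=[-\infty,+\infty]$, $0\times(+\infty)=[0,+\infty]$, $0\times(-\infty)=[-\infty,0]$. Point-wise operations: $(f+g)(x)=f(x)+g(x)$, $(f\times g)(x)=f(x)\times g(x)$. Ring operations: for $f,g\in\mathbb{H}_{nf}(X)$, each of $f+g$ and $f\times g$ is S-continuous and contains exactly one H-continuous function; $f\oplus g$ is the unique H-continuous function contained in $f+g$, and $f\otimes g$ is the unique H-continuous function contained in $f\times g$. With these operations $\mathbb{H}_{nf}(X)$ is a commutative ring containing $C(X)$ as a subring. Put $f\ominus g=f\oplus(-1)g$. Metric on $\mathbb{H}_{nf}(X)$: \[ \rho(f,g)=\sup_{x\in X\setminus(\Gamma_f\cup\Gamma_g)}\frac{|(f\ominus g)(x)|}{1+|(f\ominus g)(x)|}. \] On $C(X)$ it is the supremum over $X$ of $\frac{|f-g|}{1+|f-g|}$. Ring of quotients: a commutative ring $B$ with identity is a rational extension (ring of quotients) of a subring $A$ with the same identity if for every $b\in B$ no nonzero element of $B$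 annihilates $b^{-1}A=\{a\in A: ba\in A\}$. $\mathcal{Q}(A)$ denotes the maximal rational extension of $A$. The ring $\mathcal{Q}(C(X))$ is identified (over $C(X)$) with the subring $\mathbb{H}_{nd}(X)=\{f\in\mathbb{H}_{nf}(X):\overline{W_f}\text{ is nowhere dense in }X\}$ of $\mathbb{H}_{nf}(X)$, and carries the restriction of the metric $\rho$. $\overline{\mathcal{Q}(C(X))}$ denotes the metric completion of $\mathcal{Q}(C(X))$ with respect to $\rho$.
   Formalization: The products 0×(+∞) and 0×(−∞) are taken to be [−∞,+∞] instead of [0,+∞] and [−∞,0]; with the printed values f⊗g is undefined for f(x)=x, g(x)=1/x², g(0)=+∞ on the real line. *)

(* Defs.v *)
(* MathComp / MathComp-Analysis *)
From HB Require Import structures.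
From mathcomp Require Import all_boot all_order all_algebra.
From mathcomp Require Import all_classical all_reals all_analysis.

Set Implicit Arguments.
Unset Strict Implicit.
Unset Printing Implicit Defensive.

Import Order.TTheory GRing.Theory Num.Theory.
Import numFieldNormedType.Exports.

Local Open Scope classical_set_scope.
Local Open Scope ring_scope.

(* The ring C(X) of continuous real functions is [continuousType X R]. The    *)
(* ring may be trivial (X is allowed to be empty), hence comPzRingType here   *)
(* and below.                                                                 *)
Section ContinuousRing.
Variables (X : topologicalType) (R : realType).

Definition ctsfun : {pred X -> R} := mem [set f | continuous f].

Definition ctsfun_Sub (f : X -> R) (fP : f \in ctsfun) : continuousType X R :=
  mkcts (set_mem fP : continuous f).

Let ctsfun_rect (K : continuousType X R -> Type) :
  (forall f (fP : f \in ctsfun), K (ctsfun_Sub fP)) ->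
  forall u : continuousType X R, K u.
Proof.
move=> Ksub u; have uP : (u : X -> R) \in ctsfun by apply/mem_set/cts_fun.
by rewrite (_ : u = ctsfun_Sub uP) //; apply/continuousEP.
Qed.

HB.instance Definition _ :=
  @isSub.Build (X -> R) ctsfun (continuousType X R) (@Continuous.sort X R)
    ctsfun_Sub ctsfun_rect (fun _ _ => erefl).

Lemma ctsfun_subring_closed : subring_closed ctsfun.
Proof.
split=> [|f g|f g]; rewrite !inE /=.
- by move=> x; apply: cvg_cst.
- by move=> cf cg x; apply: cvgB; [exact: cf|exact: cg].
- by move=> cf cg x; apply: cvgM; [exact: cf|exact: cg].
Qed.

HB.instance Definition _ :=
  GRing.SubChoice_isSubComPzRing.Build _ _ (continuousType X R)
    ctsfun_subring_closed.

End ContinuousRing.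

Section RingOfQuotients.

Definition rational_extension (A B : comPzRingType) (i : {rmorphism A -> B}) :=
  injective i /\
  forall b c : B,
    (forall a : A, (exists a' : A, b * i a = i a') -> c * i a = 0) -> c = 0.

(* A maximal rational extension is one into which every rational extension    *)
(* of A embeds over A; it is unique up to a unique isomorphism over A.        *)
Definition maximal_rational_extension (A Q : comPzRingType)
    (i : {rmorphism A -> Q}) :=
  rational_extension i /\
  forall (B : comPzRingType) (j : {rmorphism A -> B}),
    rational_extension j ->
    exists h : {rmorphism B -> Q}, injective h /\ forall a, h (j a) = i a.

End RingOfQuotients.

Section MetricCompletion.
Variable R : realType.

Definition is_metric (T : Type) (d : T -> T -> R) :=
  [/\ forall x y, 0 <= d x y,
      forall x y, d x y = 0 <-> x = y,
      forall x y, d x y = d y x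
    & forall x y z, d x z <= d x y + d y z].

Definition metric_complete (T : Type) (d : T -> T -> R) :=
  forall u : nat -> T,
    (forall e, 0 < e ->
       exists N, forall m n, (N <= m)%N -> (N <= n)%N -> d (u m) (u n) < e) ->
    exists l, forall e, 0 < e -> exists N, forall n, (N <= n)%N -> d (u n) l < e.

Definition is_metric_completion (S T : Type) (dS : S -> S -> R)
    (dT : T -> T -> R) (i : S -> T) :=
  [/\ is_metric dT, metric_complete dT,
      forall x y, dT (i x) (i y) = dS x y
    & forall y e, 0 < e -> exists x, dT (i x) y < e].

End MetricCompletion.

Section Intervals.
Variable R : realType.
Local Open Scope ereal_scope.

Record ival := Ival { iends : \bar R * \bar R; _ : iends.1 <= iends.2 }.

HB.instance Definition _ := [isSub for iends].
HB.instance Definition _ := [Choice of ival by <:].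

Implicit Types (a b : \bar R) (A B : ival).

Definition lo A := (iends A).1.
Definition hi A := (iends A).2.

Definition ipt a : ival := @Ival (a, a) (lexx a).

Definition iset A : set (\bar R) := [set y | lo A <= y <= hi A].

Definition modulus A : \bar R := maxe `|lo A| `|hi A|.

Definition width A : \bar R :=
  match lo A, hi A with
  | r%:E, s%:E => (s - r)%:E
  | a, b => if a == b then 0 else +oo
  end.

Definition eadd_set a b : set (\bar R) :=
  match a, b with
  | +oo, -oo | -oo, +oo => setT
  | _, _ => [set a + b]
  end.

(* An infinite value times 0 is the whole extended line, i.e. the set of all  *)
(* limits of products u * v with u -> 0 and v -> +oo (or -oo). The one-sided  *)
(* values [0, +oo] and [-oo, 0] would not do: for f(x) = x and g(x) = x^-2 on *)
(* the real line (g(0) = +oo), the product f * g has to contain both -oo and  *)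
(* +oo at 0 to be S-continuous, or to contain any S-continuous function.      *)
Definition emul_set a b : set (\bar R) :=
  if ((a == 0) && (b \isn't a fin_num)) || ((b == 0) && (a \isn't a fin_num))
  then setT else [set a * b].

Definition iadd A B : set (\bar R) :=
  \bigcup_(a in iset A) \bigcup_(b in iset B) eadd_set a b.

Definition imul A B : set (\bar R) :=
  \bigcup_(a in iset A) \bigcup_(b in iset B) emul_set a b.

End Intervals.

Section HausdorffContinuous.
Variables (X : topologicalType) (R : realType).
Implicit Types (f g h : X -> ival R).

Definition S_continuous f :=
  closed [set p : X * \bar R | iset (f p.1) p.2].

Definition H_continuous f :=
  S_continuous f /\
  forall h, S_continuous h -> (forall x, iset (h x) `<=` iset (f x)) -> h = f.

Definition nowhere_dense (A : set X) := interior (closure A) = set0.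

Definition Wset f : set X := [set x | (0 < width (f x))%E].

Definition Gammaset f : set X := [set x | iset (f x) -oo%E \/ iset (f x) +oo%E].

Definition Hnf : set (X -> ival R) :=
  [set f | [/\ H_continuous f, closed (Gammaset f) & nowhere_dense (Gammaset f)]].

Definition Hnd : set (X -> ival R) :=
  [set f | Hnf f /\ nowhere_dense (closure (Wset f))].

(* The unique H-continuous function contained in F. The default value 0 is    *)
(* irrelevant for sums and products of nearly finite H-continuous functions.  *)
Definition H_inside (F : X -> set (\bar R)) : X -> ival R :=
  xget (fun=> ipt 0%E)
    [set h | H_continuous h /\ forall x, iset (h x) `<=` F x].

Definition oplus f g := H_inside (fun x => iadd (f x) (g x)).
Definition otimes f g := H_inside (fun x => imul (f x) (g x)).
Definition ominus f g := oplus f (otimes (fun=> ipt (- 1%:E)%E) g).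

(* Outside Gammaset f and Gammaset g the modulus is finite, so that [fine]    *)
(* loses nothing; the supremum is over a set bounded by 1.                    *)
Definition rho f g : R :=
  sup [set fine (modulus (ominus f g x)) / (1 + fine (modulus (ominus f g x)))
      | x in ~` (Gammaset f `|` Gammaset g)].

Definition rho_nf (f g : Hnf) : R := rho (\val f) (\val g).

Definition of_cts (u : continuousType X R) : X -> ival R :=
  fun x => ipt (u x)%:E.

(* phi identifies the extension i : C(X) -> Q with the subring Hnd of Hnf,    *)
(* over C(X).                                                                 *)
Definition Hnd_identification (Q : comPzRingType)
    (i : {rmorphism continuousType X R -> Q}) (phi : Q -> Hnf) :=
  [/\ injective phi,
      forall p q, \val (phi (p + q)) = oplus (\val (phi p)) (\val (phi q)),
      forall p q, \val (phi (p * q)) = otimes (\val (phi p)) (\val (phi q)),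
      forall u, \val (phi (i u)) = of_cts u
    & range (fun q => \val (phi q)) = Hnd].

End HausdorffContinuous.

Arguments Hnf X R : clear implicits.
Arguments Hnd X R : clear implicits.

(* Main.v *)
Require Import Defs.
From HB Require Import structures.
From mathcomp Require Import all_boot all_order all_algebra.
From mathcomp Require Import all_classical all_reals all_analysis.
From mathcomp Require Import ring lra.
Import Order.TTheory GRing.Theory Num.Theory.
Import numFieldNormedType.Exports.
Set Implicit Arguments.
Unset Strict Implicit.
Unset Printing Implicit Defensive.
Local Open Scope classical_set_scope.
Local Open Scope ring_scope.

(** An S-continuous function f is a pair of a lower semicontinuous function
    [lo f] and an upper semicontinuous function [hi f] above it
    ([S_continuousP]), and f is H-continuous when each of the two is the
    semicontinuous envelope of the other ([H_continuousP]).  In that case an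
    inequality [lo f <= hi g + t] that holds on a dense set propagates to
    [lo f <= lo g + t] on the whole space ([H_continuous_le]).  This one
    principle gives uniqueness (H-continuous functions whose values meet on a
    dense set are equal) and all the estimates below.

    The metric.  The distance [rho f g] is at most [t / (1 + t)] exactly when
    [lo f] and [lo g] differ by at most t everywhere ([rhoP]).  The point is that
    f(x) - g(x) may be wide, but an H-continuous function has small oscillation
    on a dense set ([H_continuous_oscillation]).  So rho is the
    uniform distance after a bounded change of scale, and is a metric.  A Cauchy
    sequence has a limit because the intervals
    [sup (lo u_m - e), inf (hi u_m + e)], over the pairs (m, e) such that the
    tail of the sequence from m on stays within e of u_m, form an S-continuous
    function, and each S-continuous function contains an H-continuous one
    ([rho_complete]).

    Density.  Given f and e > 0, rounding [lo f] down to the multiples of e gives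
    a function within e of f.  It takes, near suitable points of every open set,
    its largest local value and is constant there; hence it is locally constant
    on a dense open set and defines an element of the ring Hnd
    ([Hnd_approximation]).

    The ring of quotients.  An element of Hnd is the same thing as a continuous
    real function on a dense open set, up to agreement on a smaller dense open
    set; the ring operations are the pointwise ones there.  This makes Hnd a
    commutative ring.  That it is a rational extension of C(X) uses bump functions
    ([nd_incl_rational]).  It contains every rational extension B of C(X): to
    b in B corresponds the function a' / a on the set of points where some a with
    b a = a' in C(X) does not vanish, and rationality makes this open set dense
    ([nd_incl_maximal]).  Two maximal rational extensions are isomorphic over the
    base ring ([maximal_rational_iso]), which identifies Q with Hnd. *)

(** * Extended reals and semicontinuity *)

Section ExtendedReals.
Context {R : realType}.
Implicit Types (a b c y : \bar R).
Local Open Scope ereal_scope.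

Lemma ereal_between a b : a < b -> exists c : R, a < c%:E < b.
Proof.
case: a b => [a| |] [b| |] //= ab.
- exists ((a + b) / 2)%R; rewrite !lte_fin in ab *.
  by rewrite !(midf_lt ab).
- by exists (a + 1)%R; rewrite lte_fin ltrDl ltr01 ltry.
- by exists (b - 1)%R; rewrite lte_fin gtrDl ltrN10 ltNyr.
- by exists 0%R; rewrite ltry ltNyr.
Qed.

(** An ultrafilter converges to the supremum of its lower bounds. *)
Lemma ereal_compact : compact [set: \bar R].
Proof.
rewrite compact_ultra => F FU _.
set s := ereal_sup [set c | F [set y | c <= y]]; exists s; split=> //.
have Flt c : s < c -> F [set y | y < c].
  move=> sc; case: (in_ultra_setVsetC [set y | c <= y] FU) => [Fc|].
    have : c <= s by apply: ereal_sup_ubound.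
    by rewrite leNgt sc.
  by apply: filterS => y /= /negP; rewrite -ltNge.
have Fgt c : c < s -> F [set y | c < y].
  move=> /ereal_sup_gt[d /= Fd cd].
  by apply: filterS Fd => y /=; exact: lt_le_trans.
move=> A; clearbody s; case: s Flt Fgt => [s| |] Flt Fgt.
- case=> /= e e0 eA.
  have Fl : F [set y | (s - e)%:E < y] by apply: Fgt; rewrite lte_fin gtrDl oppr_lt0.
  have Fr : F [set y | y < (s + e)%:E] by apply: Flt; rewrite lte_fin ltrDl.
  apply: filterS (filterI Fl Fr) => -[y| |] // [/= sy ys];
    [|by []..].
  apply: eA => /=.
  by rewrite distrC ltr_distl; rewrite !lte_fin in sy ys; rewrite sy ys.
- case=> M [_ MA]; have := Fgt M%:E (ltry _).
  by apply: filterS => y; exact: MA.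
- case=> M [_ MA]; have := Flt M%:E (ltNyr _).
  by apply: filterS => y; exact: MA.
Qed.

End ExtendedReals.

Lemma open_setX (T U : topologicalType) (A : set T) (B : set U) :
  open A -> open B -> open (A `*` B).
Proof.
move=> oA oB; rewrite openE => -[x y] [/= Ax By]; exists (A, B) => //=.
by split; apply: open_nbhs_nbhs.
Qed.

Section Semicontinuity.
Context {X : topologicalType} {R : realType}.
Implicit Types (p q : X -> \bar R) (f g h : X -> ival R).
Local Open Scope ereal_scope.

(** Thresholds range over the extended reals, so that the infinite values of p
    need no separate treatment. *)
Definition lsc p := forall c, open [set x | c < p x].
Definition usc p := forall c, open [set x | p x < c].

Lemma lscN p : lsc p -> usc (fun x => - p x).
Proof.
move=> lp c; rewrite (_ : [set x | _] = [set x | - c < p x]) //.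
by apply/seteqP; split => x /=; rewrite lteNl.
Qed.

Lemma uscN p : usc p -> lsc (fun x => - p x).
Proof.
move=> up c; rewrite (_ : [set x | _] = [set x | p x < - c]) //.
by apply/seteqP; split => x /=; rewrite lteNr.
Qed.

Lemma lsc_epigraph_closed p : lsc p -> closed [set z : X * \bar R | p z.1 <= z.2].
Proof.
move=> lp; rewrite -openC (_ : ~` _ =
  \bigcup_(c in [set: R]) ([set x | c%:E < p x] `*` [set y | y < c%:E])).
  apply: bigcup_open => c _; apply: open_setX; first exact: lp.
  exact: open_ereal_lt_ereal.
apply/seteqP; split=> -[x y] /=.
  move=> /negP; rewrite -ltNge => /ereal_between[c /andP[yc cp]].
  by exists c.
by case=> c _ /= [cp yc]; apply/negP; rewrite -ltNge (lt_trans yc).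
Qed.

Lemma usc_hypograph_closed p : usc p -> closed [set z : X * \bar R | z.2 <= p z.1].
Proof.
move=> up; rewrite -openC (_ : ~` _ =
  \bigcup_(c in [set: R]) ([set x | p x < c%:E] `*` [set y | c%:E < y])).
  apply: bigcup_open => c _; apply: open_setX; first exact: up.
  exact: open_ereal_gt_ereal.
apply/seteqP; split=> -[x y] /=.
  move=> /negP; rewrite -ltNge => /ereal_between[c /andP[yc cp]].
  by exists c.
by case=> c _ /= [cp yc]; apply/negP; rewrite -ltNge (lt_trans cp).
Qed.

Lemma ival_le (A : ival R) : lo A <= hi A.
Proof. by case: A. Qed.

Lemma iset_lo (A : ival R) : iset A (lo A).
Proof. by rewrite /iset /= lexx ival_le. Qed.

Lemma iset_hi (A : ival R) : iset A (hi A).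
Proof. by rewrite /iset /= lexx ival_le. Qed.

Lemma ival_eq (A B : ival R) : lo A = lo B -> hi A = hi B -> A = B.
Proof.
move=> eqlo eqhi; apply: val_inj; apply: injective_projections.
  exact: eqlo.
exact: eqhi.
Qed.

(** The tube lemma: K is compact, and the graph is closed. *)
Lemma graph_avoids_near f (K : set (\bar R)) x : S_continuous f -> closed K ->
  (forall y, K y -> ~ iset (f x) y) -> \forall x' \near x, forall y, K y -> ~ iset (f x') y.
Proof.
move=> cf cK Kx.
have /compact_near_coveringP nK : compact K.
  exact: subclosed_compact cK ereal_compact _.
apply: (nK _ (nbhs x) (fun x' y => ~ iset (f x') y)) => y Ky.
have : open (~` [set p : X * \bar R | iset (f p.1) p.2]) by rewrite openC.
rewrite openE => /(_ (x, y) (Kx _ Ky)) [[U V] /= [xU yV] UV].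
by exists (V, U) => // -[y' x'] [/= Vy Ux]; exact: (UV (x', y')).
Qed.

(** A closed graph forces semicontinuity of the ends because the extended line is
    compact: the points of the graph below c cannot accumulate over a fibre that
    lies above c. *)
Lemma S_continuousP f :
  S_continuous f <-> lsc (fun x => lo (f x)) /\ usc (fun x => hi (f x)).
Proof.
split=> [cf|[lf uf]]; last first.
  rewrite /S_continuous (_ : [set p | _] =
    [set z | lo (f z.1) <= z.2] `&` [set z | z.2 <= hi (f z.1)]).
    apply: closedI; first exact: (@lsc_epigraph_closed (fun x => lo (f x))).
    exact: (@usc_hypograph_closed (fun x => hi (f x))).
  by apply/seteqP; split=> -[x y] /= => [/andP[]|[? ?]] //; apply/andP.
split=> c; rewrite openE => x /= cx.
- have Kx y : y <= c -> ~ iset (f x) y.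
    by move=> yc /andP[+ _]; rewrite leNgt (le_lt_trans yc).
  have := graph_avoids_near cf (@closed_ereal_ge_ereal _ c) Kx.
  apply: filterS => x' /= P; rewrite ltNge; apply/negP => /P.
  by apply; exact: iset_lo.
- have Kx y : c <= y -> ~ iset (f x) y.
    by move=> yc /andP[_ ]; rewrite leNgt (lt_le_trans cx).
  have := graph_avoids_near cf (@closed_ereal_le_ereal _ c) Kx.
  apply: filterS => x' /= P; rewrite ltNge; apply/negP => /P.
  by apply; exact: iset_hi.
Qed.

End Semicontinuity.

(** * Envelopes and H-continuous functions *)

Section Envelopes.
Context {X : topologicalType} {R : realType}.
Implicit Types (p q : X -> \bar R) (f g h G : X -> ival R).
Local Open Scope ereal_scope.

Definition usc_envelope p (x : X) := limf_esup p (nbhs x).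
Definition lsc_envelope p (x : X) := limf_einf p (nbhs x).

Lemma lsc_envelopeE p x : lsc_envelope p x = - usc_envelope (\- p) x.
Proof. by []. Qed.

Lemma le_usc_envelope p x : p x <= usc_envelope p x.
Proof.
apply: le_ereal_inf_tmp => _ [V xV <-]; apply: ereal_sup_ubound.
by exists x => //; exact: nbhs_singleton.
Qed.

Lemma usc_envelope_usc p : usc (usc_envelope p).
Proof.
move=> c; rewrite openE => x /= /ereal_inf_lt[_ [V xV <-] Vc].
have /nbhs_interior := xV; apply: filterS => z zV /=.
by apply: le_lt_trans Vc; apply: ereal_inf_lbound; exists V.
Qed.

Lemma lt_usc_envelope p x c U : c < usc_envelope p x -> nbhs x U -> exists2 z, U z & c < p z.
Proof.
move=> cp xU.
have /ereal_sup_gt[_ [z Uz <-] cz] : c < ereal_sup (p @` U).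
  by apply: lt_le_trans cp _; apply: ereal_inf_lbound; exists U.
by exists z.
Qed.

Lemma usc_envelope_min p q : usc q -> (forall x, p x <= q x) -> forall x, usc_envelope p x <= q x.
Proof.
move=> uq pq x; rewrite leNgt; apply/negP => /ereal_between[c /andP[qc cp]].
have xq : nbhs x [set x | q x < c%:E] by apply: open_nbhs_nbhs; split => //; exact: uq.
have [z /= qz cz] := lt_usc_envelope cp xq.
by have := lt_trans cz (le_lt_trans (pq z) qz); rewrite ltxx.
Qed.

Lemma ge_lsc_envelope p x : lsc_envelope p x <= p x.
Proof. by rewrite lsc_envelopeE leeNl; exact: (le_usc_envelope (\- p)). Qed.

Lemma lsc_envelope_lsc p : lsc (lsc_envelope p).
Proof. exact/uscN/usc_envelope_usc. Qed.

Lemma gt_lsc_envelope p x c U : lsc_envelope p x < c -> nbhs x U -> exists2 z, U z & p z < c.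
Proof.
rewrite lsc_envelopeE lteNl => cp /(lt_usc_envelope cp)[z Uz cz]; exists z => //.
by rewrite -lteN2.
Qed.

Lemma lsc_envelope_max p q : lsc q -> (forall x, q x <= p x) -> forall x, q x <= lsc_envelope p x.
Proof.
move=> lq qp x; rewrite lsc_envelopeE leeNr; apply: (@usc_envelope_min _ (fun z => - q z)); first exact: lscN.
by move=> z; rewrite leeN2.
Qed.

Lemma subset_isetP (A B : ival R) :
  iset A `<=` iset B <-> lo B <= lo A /\ hi A <= hi B.
Proof.
split=> [AB|[BA AB] y /= /andP[Ay yA]]; last first.
  by rewrite /iset /= (le_trans BA Ay) (le_trans yA AB).
by have /andP[? _] := AB _ (iset_lo A); have /andP[_ ?] := AB _ (iset_hi A).
Qed.

(** Minimality says that neither end can be improved: [hi f] is the upper envelope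
    of [lo f] and [lo f] is the lower envelope of [hi f]. *)
Lemma H_continuousP f : H_continuous f <->
  [/\ S_continuous f,
      forall x c U, c < hi (f x) -> nbhs x U -> exists2 z, U z & c < lo (f z)
    & forall x c U, lo (f x) < c -> nbhs x U -> exists2 z, U z & hi (f z) < c].
Proof.
split=> [[cf fmin]|[cf fhi flo]]; last first.
  split=> // h ch hf; apply/funext => x.
  have /subset_isetP[lofh hihf] := hf x.
  move/S_continuousP: ch => [lh uh].
  apply: ival_eq; apply/eqP; rewrite eq_le ?lofh ?hihf ?andbT /= leNgt;
    apply/negP => /ereal_between[c /andP[c1 c2]].
  - have xU : nbhs x [set z | c%:E < lo (h z)].
      by apply: open_nbhs_nbhs; split => //; exact: lh.
    have [z /= Uz zc] := flo _ _ _ c1 xU.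
    have /subset_isetP[_ hihfz] := hf z.
    have := lt_trans (lt_le_trans Uz (le_trans (ival_le _) hihfz)) zc.
    by rewrite ltxx.
  - have xU : nbhs x [set z | hi (h z) < c%:E].
      by apply: open_nbhs_nbhs; split => //; exact: uh.
    have [z /= Uz zc] := fhi _ _ _ c2 xU.
    have /subset_isetP[lofhz _] := hf z.
    have := lt_trans (lt_le_trans zc (le_trans lofhz (ival_le _))) Uz.
    by rewrite ltxx.
have [lf uf] := (S_continuousP _).1 cf; split=> // x c U.
- pose h z := @Ival _ (lo (f z), usc_envelope (fun x => lo (f x)) z) (le_usc_envelope _ z).
  have <- : h = f.
    apply: fmin => [|z]; first by apply/S_continuousP; split => //; exact: usc_envelope_usc.
    apply/subset_isetP; split; rewrite /= ?lexx//.
    by apply: (usc_envelope_min uf) => ?; exact: ival_le.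
  exact: lt_usc_envelope.
- pose h z := @Ival _ (lsc_envelope (fun x => hi (f x)) z, hi (f z)) (ge_lsc_envelope _ z).
  have <- : h = f.
    apply: fmin => [|z]; first by apply/S_continuousP; split => //; exact: lsc_envelope_lsc.
    apply/subset_isetP; split; rewrite /= ?lexx//.
    by apply: (lsc_envelope_max lf) => ?; exact: ival_le.
  exact: gt_lsc_envelope.
Qed.

(** The existence half of the definition of the ring operations. *)
Lemma H_continuous_inside G : S_continuous G ->
  exists h, H_continuous h /\ forall x, iset (h x) `<=` iset (G x).
Proof.
move=> /S_continuousP[lG uG].
(* the upper envelope of l, which will be the upper end, stays below u, the
   least upper semicontinuous function above lo G *)
pose u := usc_envelope (fun x => lo (G x)); pose l := lsc_envelope u.
have vu x : usc_envelope l x <= u x by apply: usc_envelope_min => [|?]; [exact: usc_envelope_usc|exact: ge_lsc_envelope].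
pose h z := @Ival _ (l z, usc_envelope l z) (le_usc_envelope _ z).
exists h; split.
  apply/H_continuousP; split.
  - by apply/S_continuousP; split; [exact: lsc_envelope_lsc|exact: usc_envelope_usc].
  - by move=> x c U; exact: lt_usc_envelope.
  - move=> x c U xc xU; have [z Uz zc] := gt_lsc_envelope xc xU.
    by exists z => //; exact: le_lt_trans (vu z) zc.
move=> x; apply/subset_isetP; split.
  by apply: (@lsc_envelope_max u (fun z => lo (G z))) => // z; exact: (le_usc_envelope (fun z => lo (G z))).
apply: (le_trans (vu x)); by apply: (usc_envelope_min uG) => ?; exact: ival_le.
Qed.

(** If [lo g x + t < lo f x] then [hi g + t] would be smaller than [lo f] on a
    nonempty open set near x, hence somewhere in D. *)
Lemma H_continuous_le f g (D : set X) (t : R) : H_continuous f -> H_continuous g ->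
  dense D -> (forall x, D x -> lo (f x) <= hi (g x) + t%:E) ->
  forall x, lo (f x) <= lo (g x) + t%:E.
Proof.
move=> /H_continuousP[/S_continuousP[lf _] _ _].
move=> /H_continuousP[/S_continuousP[_ ug] _ glo] dD fgD x.
rewrite leNgt; apply/negP => /ereal_between[c /andP[gc cf]].
move: gc; rewrite -lteBrDr// -EFinB => gc.
have xU : nbhs x [set z | c%:E < lo (f z)] by apply: open_nbhs_nbhs; split => //; exact: lf.
have [z /= cz zc] := glo _ _ _ gc xU.
have [y [[yc cy] Dy]] : ([set z | hi (g z) < (c - t)%:E] `&`
    [set z | c%:E < lo (f z)] `&` D) !=set0.
  by apply: dD; [exists z|apply: openI; [exact: ug|exact: lf]].
move: yc; rewrite /= EFinB lteBrDr// => yc.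
by have := lt_trans (lt_le_trans cy (fgD _ Dy)) yc; rewrite ltxx.
Qed.

Lemma H_continuous_hi_le f g (t : R) : H_continuous f -> H_continuous g ->
  (forall x, lo (f x) <= lo (g x) + t%:E) -> forall x, hi (f x) <= hi (g x) + t%:E.
Proof.
move=> /H_continuousP[_ fhi _] /H_continuousP[/S_continuousP[_ ug] _ _] fg x.
rewrite leNgt -lteBrDr//; apply/negP => /ereal_between[c /andP[gc cf]].
have xU : nbhs x [set z | hi (g z) < c%:E] by apply: open_nbhs_nbhs; split => //; exact: ug.
move: cf; rewrite lteBrDr// => cf; have [z /= zc cz] := fhi _ _ _ cf xU.
have := lt_le_trans cz (fg z); rewrite lteD2rE// => /lt_le_trans/(_ (ival_le _)).
by move/lt_trans/(_ zc); rewrite ltxx.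
Qed.

(** The case t = 0: an H-continuous function is determined by its values on a
    dense set. *)
Lemma H_continuous_eq f g (D : set X) : H_continuous f -> H_continuous g ->
  dense D -> (forall x, D x -> lo (f x) <= hi (g x)) ->
  (forall x, D x -> lo (g x) <= hi (f x)) -> f = g.
Proof.
move=> Hf Hg dD fg gf.
have fg0 x : lo (f x) <= lo (g x) + 0%R%:E.
  by apply: (H_continuous_le Hf Hg dD) => z Dz; rewrite adde0 fg.
have gf0 x : lo (g x) <= lo (f x) + 0%R%:E.
  by apply: (H_continuous_le Hg Hf dD) => z Dz; rewrite adde0 gf.
apply/funext => x; apply: ival_eq; apply/eqP; rewrite eq_le.
  by have := fg0 x; have := gf0 x; rewrite !adde0 => -> ->.
have := H_continuous_hi_le Hf Hg fg0 x; have := H_continuous_hi_le Hg Hf gf0 x.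
by rewrite !adde0 => -> ->.
Qed.

(** Widths are small somewhere in each open set, although f may have positive
    width at every point: just below an upper end [hi f x] there are nearby values
    of [lo f], while [hi f] is nearly bounded by [hi f x]. *)
Lemma H_continuous_oscillation f (V : set X) (e : R) : H_continuous f -> open V ->
  V !=set0 -> (forall x, V x -> hi (f x) \is a fin_num) -> (0 < e)%R ->
  exists2 z, V z & hi (f z) <= lo (f z) + e%:E.
Proof.
move=> /H_continuousP[/S_continuousP[_ uf] fhi _] oV [x Vx] Vfin e0.
set r := fine (hi (f x)); have fxr : hi (f x) = r%:E by rewrite fineK ?Vfin.
have xU : nbhs x (V `&` [set z | hi (f z) < (r + e / 2)%:E]).
  apply: open_nbhs_nbhs; split; first by apply: openI => //; exact: uf.
  by split=> //=; rewrite fxr lte_fin ltrDl divr_gt0.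
have cf : (r - e / 2)%:E < hi (f x) by rewrite fxr lte_fin gtrDl oppr_lt0 divr_gt0.
have [z [Vz /= zr] rz] := fhi _ _ _ cf xU.
exists z => //; apply: (le_trans (ltW zr)).
rewrite -leeBlDr// -EFinB; apply: le_trans (ltW rz).
by rewrite lee_fin {2}(splitr e) opprD addrA addrK.
Qed.

End Envelopes.

(** * Sums and products of interval functions *)

Section ClosedBounds.
Context {R : realType}.
Local Open Scope ereal_scope.
Implicit Types (C : set (\bar R)).

Lemma closed_ereal_inf C : closed C -> C !=set0 -> C (ereal_inf C).
Proof.
move=> cC [y0 Cy0]; apply: cC => B.
have lb y : C y -> ereal_inf C <= y by move=> Cy; exact: ereal_inf_lbound.
have adh c : ereal_inf C < c -> exists2 y, C y & y < c by exact: ereal_inf_lt.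
move: (ereal_inf C) lb adh => -[s| |] lb adh.
- case=> /= e e0 eB; have [|y Cy ys] := adh (s + e)%:E; first by rewrite lte_fin ltrDl.
  exists y; split => //; have := lb y Cy; case: y ys {Cy} => // y.
  rewrite lte_fin lee_fin => ys sy; apply: eB => /=.
  by rewrite distrC ger0_norm ?subr_ge0// ltrBlDl.
- move=> /nbhs_singleton By; exists y0; split => //.
  by have := lb _ Cy0; rewrite leye_eq => /eqP ->.
- case=> M [_ MB]; have [|y Cy ys] := adh M%:E; first exact: ltNyr.
  by exists y; split => //; exact: MB.
Qed.

Lemma closed_ereal_sup C : closed C -> C !=set0 -> C (ereal_sup C).
Proof.
move=> cC [y0 Cy0]; rewrite ereal_supEN.
have : (-%E @` C) (ereal_inf (-%E @` C)); last by case=> z Cz <-; rewrite oppeK.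
apply: closed_ereal_inf; last by exists (- y0), y0.
rewrite (_ : _ @` _ = -%E @^-1` C).
  by apply: closed_comp => // x _; exact: oppe_continuous.
by apply/seteqP; split=> [_ [z Cz <-]|z /= Cz]; [by rewrite /= oppeK|by exists (- z); rewrite ?oppeK].
Qed.

End ClosedBounds.

Lemma fst_cts (T U : topologicalType) : continuous (@fst T U).
Proof. by move=> [x y]; exact: cvg_fst. Qed.

Lemma snd_cts (T U : topologicalType) : continuous (@snd T U).
Proof. by move=> [x y]; exact: cvg_snd. Qed.

(** Sum and product of intervals have the same shape: a partial operation m that
    is continuous on an open domain, and every value allowed at the ambiguous
    pairs.  S-continuity of the pointwise operation is proved once for both. *)
Section IntervalOperation.
Context {R : realType}.
Variables (ok : \bar R -> \bar R -> bool) (m : \bar R -> \bar R -> \bar R).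
Implicit Types A B : ival R.
Local Open Scope ereal_scope.

Definition partial_op a b : set (\bar R) := if ok a b then [set m a b] else setT.
Definition ival_op A B := \bigcup_(a in iset A) \bigcup_(b in iset B) partial_op a b.

Hypothesis ok_open : open [set p | ok p.1 p.2].
Hypothesis m_cvg : forall a b, ok a b -> m p.1 p.2 @[p --> nbhs (a, b)] --> m a b.
Hypothesis okC : forall a b, ok a b = ok b a.
Hypothesis mC : forall a b, m a b = m b a.
Hypothesis m_ivt : forall A b a a' y, (forall c, iset A c -> ok c b) ->
  iset A a -> iset A a' -> m a b <= y <= m a' b -> exists2 c, iset A c & m c b = y.

(** Allowing every value outside of the domain of m makes the graph closed. *)
Lemma partial_op_closed : closed [set q : (\bar R * \bar R) * \bar R | partial_op q.1.1 q.1.2 q.2].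
Proof.
rewrite -openC openE => -[[a b] y] /=; rewrite /partial_op.
case: ifPn => [okab|_] /=; last by case.
move=> yab.
have mab : m a b != y by apply/eqP => /esym.
have := @ereal_hausdorff R; rewrite open_hausdorff => /(_ _ _ mab).
case=> -[U V] /= [/set_mem Um /set_mem Vy] [oU oV UV].
exists ([set p | ok p.1 p.2] `&` [set p | U (m p.1 p.2)], V) => /=.
  split; last exact: open_nbhs_nbhs.
  apply: filterI; first by apply: open_nbhs_nbhs.
  by apply: (m_cvg okab); apply: open_nbhs_nbhs.
move=> [[a' b'] y'] /= [[ok' Um'] Vy']; rewrite ok' /= => yE.
suff : (U `&` V) y' by rewrite (eqP UV).
by split=> //; rewrite yE.
Qed.

(** The graph is the projection of a closed set along a compact factor, the square
    of the extended line. *)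
Lemma ival_op_closed (X : topologicalType) (f g : X -> ival R) :
  S_continuous f -> S_continuous g ->
  closed [set p : X * \bar R | ival_op (f p.1) (g p.1) p.2].
Proof.
move=> cf cg; rewrite -openC openE => p /= fgp; rewrite /interior.
pose C : set ((\bar R * \bar R) * (X * \bar R)) :=
  (fun q => (q.2.1, q.1.1)) @^-1` [set p | iset (f p.1) p.2] `&`
  ((fun q => (q.2.1, q.1.2)) @^-1` [set p | iset (g p.1) p.2] `&`
  (fun q => (q.1, q.2.2)) @^-1` [set q | partial_op q.1.1 q.1.2 q.2]).
have cC : closed C.
  apply: closedI.
    apply: closed_comp cf => q _; apply: cvg_pair.
      by apply: (continuous_comp (f := snd) (g := fst)); [exact: snd_cts|exact: fst_cts].
    by apply: (continuous_comp (f := fst) (g := fst)); exact: fst_cts.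
  apply: closedI.
    apply: closed_comp cg => q _; apply: cvg_pair.
      by apply: (continuous_comp (f := snd) (g := fst)); [exact: snd_cts|exact: fst_cts].
    by apply: (continuous_comp (f := fst) (g := snd)); [exact: fst_cts|exact: snd_cts].
  apply: closed_comp partial_op_closed => q _.
  apply: (@cvg_pair _ _ _ (nbhs q) (nbhs q.1) (nbhs q.2.2) _ _ _ fst (fun q => q.2.2)).
    exact: fst_cts.
  by apply: (continuous_comp (f := snd) (g := snd)); exact: snd_cts.
have /compact_near_coveringP nK : compact ([set: \bar R] `*` [set: \bar R]).
  by apply: compact_setX; exact: ereal_compact.
have : \forall q \near p, [set: \bar R] `*` [set: \bar R] `<=` (fun ab => ~ C (ab, q)).
  apply: (nK _ (nbhs p) (fun q ab => ~ C (ab, q))) => ab _.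
  have : nbhs (ab, p) (~` C).
    apply: open_nbhs_nbhs; split; first by rewrite openC.
    move=> [/= fa [gb yab]]; apply: fgp.
    by exists ab.1 => //; exists ab.2.
  by apply: filterS => -[].
apply: filterS => q qC [a fa [b gb yab]].
by apply: (qC (a, b)).
Qed.

(** Convexity has to be proved apart because [partial_op] jumps; if an ambiguous
    pair occurs in the box there is nothing to prove, and otherwise the
    intermediate value property applies in each variable. *)
Lemma ival_op_convex A B y1 y2 y : ival_op A B y1 -> ival_op A B y2 ->
  y1 <= y <= y2 -> ival_op A B y.
Proof.
have [[a [b [Aa Bb okab]]]|/forallNP allok] :=
    pselect (exists a b, [/\ iset A a, iset B b & ~~ ok a b]).
  by move=> _ _ _; exists a => //; exists b => //; rewrite /partial_op (negbTE okab).
have okAB a b : iset A a -> iset B b -> ok a b.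
  by move=> Aa Bb; apply/negPn/negP => okab; apply: (allok a); exists b.
have opE a b : iset A a -> iset B b -> partial_op a b = [set m a b].
  by move=> Aa Bb; rewrite /partial_op okAB.
move=> [a Aa [b Bb]]; rewrite opE// => /= -> {y1}.
move=> [a' Aa' [b' Bb']]; rewrite opE// => /= -> {y2} /andP[y1 y2].
(* go from (a, b) to (a', b') through the corner (a', b) *)
have [yz|/ltW zy] := leP y (m a' b).
  have okb c : iset A c -> ok c b by move=> Ac; exact: okAB.
  have yab : m a b <= y <= m a' b by rewrite y1.
  by have [c Ac <-] := m_ivt okb Aa Aa' yab; exists c => //; exists b => //; rewrite opE.
have oka c : iset B c -> ok c a' by move=> Bc; rewrite okC okAB.
have yab : m b a' <= y <= m b' a' by rewrite -!(mC a') zy.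
have [c Bc <-] := m_ivt oka Bb Bb' yab.
by exists a' => //; exists c => //; rewrite opE//= mC.
Qed.

(** Closed, convex, nonempty subsets of the extended line are intervals. *)
Lemma S_continuous_op (X : topologicalType) (f g : X -> ival R) :
  S_continuous f -> S_continuous g ->
  exists G, S_continuous G /\ forall x, iset (G x) = ival_op (f x) (g x).
Proof.
move=> cf cg; have cF := ival_op_closed cf cg.
have cFx x : closed (ival_op (f x) (g x)).
  have := @closed_comp _ _ (fun y : \bar R => (x, y)) _ _ cF; apply.
  by move=> y _; apply: cvg_pair => //; exact: cvg_cst.
have F0 x : ival_op (f x) (g x) !=set0.
  exists (m (lo (f x)) (lo (g x))); exists (lo (f x)); first exact: iset_lo.
  by exists (lo (g x)); [exact: iset_lo|rewrite /partial_op; case: ifP].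
have infsup x : ereal_inf (ival_op (f x) (g x)) <= ereal_sup (ival_op (f x) (g x)).
  by apply: ereal_inf_lbound; exact: closed_ereal_sup.
pose G x := @Ival R (_, _) (infsup x).
have GE x : iset (G x) = ival_op (f x) (g x).
  apply/seteqP; split => y /=.
    by apply: ival_op_convex; [exact: closed_ereal_inf|exact: closed_ereal_sup].
  by move=> Fy; rewrite /iset /= ereal_inf_lbound// ereal_sup_ubound.
exists G; split => //; rewrite /S_continuous; under eq_set do rewrite GE; exact: cF.
Qed.

Lemma H_continuous_op (X : topologicalType) (f g : X -> ival R) :
  S_continuous f -> S_continuous g ->
  exists h, H_continuous h /\ forall x, iset (h x) `<=` ival_op (f x) (g x).
Proof.
move=> cf cg; have [G [cG GE]] := S_continuous_op cf cg.
by have [h [Hh hG]] := H_continuous_inside cG; exists h; split => // x; rewrite -GE.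
Qed.

End IntervalOperation.

Section SumsAndProducts.
Context {R : realType}.
Implicit Types (a b c y : \bar R) (A B : ival R).
Local Open Scope ereal_scope.

Lemma closed_ereal_eq (T : topologicalType) (p : T -> \bar R) (c : \bar R) :
  continuous p -> closed [set x | p x = c].
Proof.
move=> cp; apply: (@closed_comp _ _ p [set c]) => [x _|]; first exact: cp.
exact/accessible_closed_set1/hausdorff_accessible/ereal_hausdorff.
Qed.

Lemma adde_def_open : open [set p : \bar R * \bar R | p.1 +? p.2].
Proof.
rewrite -closedC (_ : ~` _ =
  ([set p | p.1 = +oo] `&` [set p | p.2 = -oo]) `|`
  ([set p | p.1 = -oo] `&` [set p | p.2 = +oo])).
  by apply: closedU; apply: closedI; apply: closed_ereal_eq;
    by [exact: fst_cts|exact: snd_cts].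
apply/seteqP; split=> -[a b] /=; rewrite /adde_def -negb_or.
  by move=> /negP/negPn/orP[/andP[/eqP -> /eqP ->]|/andP[/eqP -> /eqP ->]]; [left|right].
by case=> -[-> ->].
Qed.

Lemma mule_def_open : open [set p : \bar R * \bar R | p.1 *? p.2].
Proof.
rewrite -closedC (_ : ~` _ =
  ([set p | p.1 = 0] `&` ([set p | p.2 = -oo] `|` [set p | p.2 = +oo])) `|`
  ([set p | p.2 = 0] `&` ([set p | p.1 = -oo] `|` [set p | p.1 = +oo]))).
  by apply: closedU; apply: closedI; [|apply: closedU| |apply: closedU];
    apply: closed_ereal_eq; by [exact: fst_cts|exact: snd_cts].
apply/seteqP; split=> -[[a| |] [b| |]] //=; rewrite /mule_def //=.
- by move=> /negP/negPn/eqP ->; left; split => //; right.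
- by move=> /negP/negPn/eqP ->; left; split => //; left.
- by move=> /negP/negPn/eqP ->; right; split => //; right.
- by move=> /negP/negPn/eqP ->; right; split => //; left.
- by case=> -[] // _ [].
- by case=> -[] // [->] _; rewrite eqxx.
- by case=> -[] // [->] _; rewrite eqxx.
- by case=> -[] // [->] _; rewrite eqxx.
- by case=> -[].
- by case=> -[].
- by case=> -[] // [->] _; rewrite eqxx.
- by case=> -[].
- by case=> -[].
Qed.

Lemma adde_ivt A b a a' y : (forall c, iset A c -> c +? b) ->
  iset A a -> iset A a' -> a + b <= y <= a' + b -> exists2 c, iset A c & c + b = y.
Proof.
case: b => [b| |] ok Aa Aa' /andP[ay ya].
- exists (y - b%:E); last by rewrite subeK.
  have {}ay : a <= y - b%:E by rewrite leeBrDr.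
  have {}ya : y - b%:E <= a' by rewrite leeBlDr.
  move: Aa Aa' => /andP[Aa _] /andP[_ Aa'].
  by rewrite /iset /= (le_trans Aa ay) (le_trans ya Aa').
- by exists a => //; move: (ok a Aa) ay; case: a Aa => [a| |] // _ _ /=; rewrite leye_eq => /eqP.
- by exists a' => //; move: (ok a' Aa') ya; case: a' Aa' => [a'| |] // _ _ /=; rewrite leeNy_eq => /eqP.
Qed.

Lemma mule_ivt A b a a' y : (forall c, iset A c -> c *? b) ->
  iset A a -> iset A a' -> a * b <= y <= a' * b -> exists2 c, iset A c & c * b = y.
Proof.
have Amid c c' d : iset A c -> iset A c' -> c <= d <= c' -> iset A d.
  move=> /andP[Ac _] /andP[_ Ac'] /andP[cd dc'].
  by rewrite /iset /= (le_trans Ac) // (le_trans dc').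
case: b => [b| |] ok Aa Aa' /andP[ay ya].
- have [b0|b0|b0] := ltgtP b 0%R.
  + exists (y * b^-1%:E).
      by apply: (Amid _ _ _ Aa' Aa); rewrite lee_ndivlMr// lee_ndivrMr// ya.
    by rewrite -muleA -EFinM mulVf ?mule1// lt_eqF.
  + exists (y * b^-1%:E).
      by apply: (Amid _ _ _ Aa Aa'); rewrite lee_pdivlMr// lee_pdivrMr// ya ay.
    by rewrite -muleA -EFinM mulVf ?mule1// gt_eqF.
  + exists a => //; move: ay ya; rewrite b0 !mule0 => ay ya.
    by apply/eqP; rewrite eq_le ay ya.
- have [a0|a0|a0] := ltgtP a 0.
  + have [a'0|a'0|a'0] := ltgtP a' 0.
    * by exists a' => //; move: ya; rewrite lt0_muley// leeNy_eq => /eqP.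
    * have /ok : iset A 0 by apply: (Amid _ _ _ Aa Aa'); rewrite !ltW.
      by rewrite /mule_def /= eqxx.
    * by have := ok _ Aa'; rewrite a'0 /mule_def /= eqxx.
  + by exists a => //; move: ay; rewrite gt0_muley// leye_eq => /eqP.
  + by have := ok _ Aa; rewrite a0 /mule_def /= eqxx.
- have [a0|a0|a0] := ltgtP a 0.
  + by exists a => //; move: ay; rewrite lt0_muleNy// leye_eq => /eqP.
  + have [a'0|a'0|a'0] := ltgtP a' 0.
    * have /ok : iset A 0 by apply: (Amid _ _ _ Aa' Aa); rewrite !ltW.
      by rewrite /mule_def /= eqxx.
    * by exists a' => //; move: ya; rewrite gt0_muleNy// leeNy_eq => /eqP.
    * by have := ok _ Aa'; rewrite a'0 /mule_def /= eqxx.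
  + by have := ok _ Aa; rewrite a0 /mule_def /= eqxx.
Qed.

Lemma eadd_setE a b : eadd_set a b = partial_op (@adde_def R) +%E a b.
Proof. by case: a b => [a| |] [b| |]. Qed.

Lemma emul_setE a b : emul_set a b = partial_op (@mule_def R) *%E a b.
Proof.
rewrite /emul_set /partial_op; case: a b => [a| |] [b| |] //=; rewrite ?andbF ?andbT ?orbF ?eqe//;
  by case: eqP.
Qed.

Variable X : topologicalType.
Implicit Types f g : X -> ival R.

Lemma H_continuous_iadd f g : S_continuous f -> S_continuous g ->
  exists h, H_continuous h /\ forall x, iset (h x) `<=` iadd (f x) (g x).
Proof.
move=> cf cg; have [|||h [Hh hfg]] := H_continuous_op adde_def_open _ _ _ adde_ivt cf cg.
- move=> a b ab; apply: cvgeD => //; [exact: (fst_cts (x := (a, b)))|exact: (snd_cts (x := (a, b)))].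
- exact: adde_defC.
- exact: addeC.
exists h; split => // x y /hfg[a fa [b gb yab]].
by exists a => //; exists b => //; rewrite eadd_setE.
Qed.

Lemma H_continuous_imul f g : S_continuous f -> S_continuous g ->
  exists h, H_continuous h /\ forall x, iset (h x) `<=` imul (f x) (g x).
Proof.
move=> cf cg; have [|||h [Hh hfg]] := H_continuous_op mule_def_open _ _ _ mule_ivt cf cg.
- move=> a b ab; apply: cvgeM => //; [exact: (fst_cts (x := (a, b)))|exact: (snd_cts (x := (a, b)))].
- exact: mule_defC.
- exact: muleC.
exists h; split => // x y /hfg[a fa [b gb yab]].
by exists a => //; exists b => //; rewrite emul_setE.
Qed.

Lemma H_insideP (F : X -> set (\bar R)) :
  (exists h, H_continuous h /\ forall x, iset (h x) `<=` F x) ->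
  H_continuous (H_inside F) /\ forall x, iset (H_inside F x) `<=` F x.
Proof. by move=> [h hF]; rewrite /H_inside; case: xgetP => [_ _ //|/(_ h)]. Qed.

Lemma oplusP f g : S_continuous f -> S_continuous g ->
  H_continuous (oplus f g) /\ forall x, iset (oplus f g x) `<=` iadd (f x) (g x).
Proof. by move=> cf cg; apply: H_insideP; exact: H_continuous_iadd. Qed.

Lemma otimesP f g : S_continuous f -> S_continuous g ->
  H_continuous (otimes f g) /\ forall x, iset (otimes f g x) `<=` imul (f x) (g x).
Proof. by move=> cf cg; apply: H_insideP; exact: H_continuous_imul. Qed.

End SumsAndProducts.

(** * The metric *)

Section Metric.
Context {X : topologicalType} {R : realType}.
Implicit Types (f g h : X -> ival R) (t e : R).

Lemma closed_nowhere_dense (A : set X) : closed A -> nowhere_dense A -> dense (~` A).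
Proof.
move=> /closure_id cA; rewrite /nowhere_dense -cA => A0 O [x Ox] oO.
apply/not_existsP => OA; suff : interior A x by rewrite A0.
have OsubA : O `<=` A by move=> y Oy; apply: contrapT => nAy; exact: (OA y).
by apply: filterS OsubA _; exact: open_nbhs_nbhs.
Qed.

Lemma nowhere_denseS (A B : set X) : A `<=` B -> nowhere_dense B -> nowhere_dense A.
Proof.
move=> AB; rewrite /nowhere_dense -!subset0; apply: subset_trans.
exact/interiorS/closureS.
Qed.

Lemma open_dense_nowhere_dense (D : set X) : open D -> dense D -> nowhere_dense (~` D).
Proof.
move=> oD dD; rewrite /nowhere_dense -(closure_id _).1; last by rewrite closedC.
rewrite -subset0 => x Dx; have [|y [yD Dy]] := dD _ _ (open_interior (~` D)).
  by exists x.
exact: interior_subset yD Dy.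
Qed.

Lemma nGammasetP f x :
  ~ Gammaset f x <-> lo (f x) \is a fin_num /\ hi (f x) \is a fin_num.
Proof.
have lh := ival_le (f x).
rewrite /Gammaset /iset /= leeNy_eq leNye leye_eq leey !andbT /=.
split=> [/not_orP[/negP l /negP h]|[l h] [/eqP E|/eqP E]].
- split; rewrite fin_numE ?l ?h ?andbT/=.
    by apply: contra h => /eqP E; rewrite -leye_eq -E.
  by apply: contra l => /eqP E; rewrite -leeNy_eq -E.
- by rewrite E in l.
- by rewrite E in h.
Qed.

Lemma Gammaset_closed f : S_continuous f -> closed (Gammaset f).
Proof.
move=> /S_continuousP[lf uf]; rewrite -openC.
rewrite (_ : ~` _ = [set x | -oo < lo (f x)]%E `&` [set x | hi (f x) < +oo]%E).
  by apply: openI; [exact: lf|exact: uf].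
apply/seteqP; split => x /=.
  by move=> /nGammasetP[]; rewrite !fin_numE !ltNye !ltey => /andP[-> _] /andP[_ ->].
move=> [l h]; apply/nGammasetP; rewrite !fin_numElt l h.
by rewrite (lt_le_trans l (ival_le _)) (le_lt_trans (ival_le _) h).
Qed.

Lemma S_continuous_cst (A : ival R) : S_continuous (fun _ : X => A).
Proof.
have open_bool (b : bool) : open [set _ : X | b].
  case: b; first by rewrite (_ : [set _ | _] = setT); [exact: openT|apply/seteqP; split].
  by rewrite (_ : [set _ | _] = set0); [exact: open0|apply/seteqP; split].
by apply/S_continuousP; split => c; exact: open_bool.
Qed.

Lemma otimesN1_bounds g x : S_continuous g ->
  (- hi (g x) <= lo (otimes (fun=> ipt (- 1%:E)) g x) /\
   hi (otimes (fun=> ipt (- 1%:E)) g x) <= - lo (g x))%E.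
Proof.
move=> cg; set k := otimes _ _.
have cN1 := @S_continuous_cst (ipt (- 1%:E)%E).
have [_ /(_ x) kN] := otimesP cN1 cg.
have bnd y : iset (k x) y -> (- hi (g x) <= y <= - lo (g x))%E.
  move=> /kN[a /= /andP[a1 a2] [b /andP[gb bg]]].
  have -> : a = (-1)%:E by apply/eqP; rewrite eq_le a2 a1.
  rewrite /emul_set /= andbF orbF eqe oppr_eq0 oner_eq0 /= EFinN mulN1e => ->.
  by rewrite !leeN2 gb bg.
by have /andP[? _] := bnd _ (iset_lo _); have /andP[_ ?] := bnd _ (iset_hi _).
Qed.

Lemma ominusP f g : S_continuous f -> S_continuous g ->
  H_continuous (ominus f g) /\
  forall x, ~ (Gammaset f `|` Gammaset g) x ->
    (lo (f x) - hi (g x) <= lo (ominus f g x) /\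
     hi (ominus f g x) <= hi (f x) - lo (g x))%E.
Proof.
move=> cf cg; have cN1 := @S_continuous_cst (ipt (- 1%:E)%E).
have [[ck _] _] := otimesP cN1 cg.
have [Hh hfk] := oplusP cf ck; split=> // x /not_orP[/nGammasetP[lf hf] /nGammasetP[lg hg]].
have [lk hk] := otimesN1_bounds x cg; rewrite /ominus.
move: lk hk hfk; set k := otimes _ _ => lk hk hfk.
have bnd y : iset (oplus f k x) y -> (lo (f x) - hi (g x) <= y <= hi (f x) - lo (g x))%E.
  move=> /hfk[a /andP[fa af] [b /andP[kb bk]]].
  have {}kb := le_trans lk kb; have {}bk := le_trans bk hk.
  have yE : a \is a fin_num -> eadd_set a b = [set (a + b)%E] by case: a b {fa af kb bk} => [a| |] [b| |].
  rewrite yE => [->|]; first by rewrite !leeD.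
  move: lf hf; rewrite !fin_numElt => /andP[lf _] /andP[_ hf].
  by rewrite (lt_le_trans lf fa) (le_lt_trans af hf).
by have /andP[? _] := bnd _ (iset_lo _); have /andP[_ ?] := bnd _ (iset_hi _).
Qed.

(** Only lower ends are compared: for H-continuous functions the same inequalities
    for upper ends follow by [H_continuous_hi_le]. *)
Definition unif_close t f g :=
  forall x, (lo (f x) <= lo (g x) + t%:E /\ lo (g x) <= lo (f x) + t%:E)%E.

Lemma H_continuous_cst t : H_continuous (fun _ : X => ipt t%:E).
Proof.
apply/H_continuousP; split.
- exact: S_continuous_cst.
- by move=> x c U /= cx xU; exists x => //; exact: nbhs_singleton.
- by move=> x c U /= cx xU; exists x => //; exact: nbhs_singleton.
Qed.

Lemma modulus_le (A : ival R) t : lo A \is a fin_num -> hi A \is a fin_num ->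
  fine (modulus A) <= t <-> ((- t)%:E <= lo A /\ hi A <= t%:E)%E.
Proof.
rewrite /modulus; have := ival_le A; case: (lo A) => [a| |] //; case: (hi A) => [b| |] //.
rewrite !lee_fin => ab _ _; rewrite -EFin_max /= ge_max !ler_norml.
split=> [/andP[/andP[-> _] /andP[_ ->]] //|[ta bt]].
by rewrite ta bt (le_trans ta ab) (le_trans ab bt).
Qed.

Lemma modulus_ge0 (A : ival R) : 0 <= fine (modulus A).
Proof. by apply: fine_ge0; rewrite /modulus le_max abse_ge0. Qed.

Lemma Hnf_open_dense f g : Hnf X R f -> Hnf X R g ->
  open (~` (Gammaset f `|` Gammaset g)) /\ dense (~` (Gammaset f `|` Gammaset g)).
Proof.
move=> [_ cf nf] [_ cg ng]; rewrite setCU; split; first by apply: openI; rewrite openC.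
by apply: denseI; rewrite ?openC//; exact: closed_nowhere_dense.
Qed.

Lemma ominus_fin f g x : S_continuous f -> S_continuous g ->
  ~ (Gammaset f `|` Gammaset g) x ->
  lo (ominus f g x) \is a fin_num /\ hi (ominus f g x) \is a fin_num.
Proof.
move=> cf cg nx; have [_ /(_ _ nx)[lk hk]] := ominusP cf cg.
move: nx => /not_orP[/nGammasetP[lf hf] /nGammasetP[lg hg]].
have lh := ival_le (ominus f g x).
have l : (-oo < lo (ominus f g x))%E.
  by apply: lt_le_trans lk; rewrite ltNye_eq fin_numB lf hg.
have h : (hi (ominus f g x) < +oo)%E.
  by apply: le_lt_trans hk _; rewrite ltey_eq fin_numB hf lg.
by rewrite !fin_numElt l h (lt_le_trans l lh) (le_lt_trans lh h).
Qed.

(** From closeness to the bound on the difference k: k(x) is only known to lie in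
    f(x) - g(x), but where the width of f or of g is below e this gives the bound
    up to e, and such points are dense.  Conversely, a bound on one element of
    f(x) - g(x) for x in a dense set suffices by [H_continuous_le]. *)
Lemma unif_close_modulus f g t : Hnf X R f -> Hnf X R g -> unif_close t f g <->
  forall x, ~ (Gammaset f `|` Gammaset g) x -> fine (modulus (ominus f g x)) <= t.
Proof.
move=> nf ng; have [oD dD] := Hnf_open_dense nf ng.
have [Hf _ _] := nf; have [Hg _ _] := ng; have [cf _] := Hf; have [cg _] := Hg.
have [Hk kfg] := ominusP cf cg; set k := ominus f g in Hk kfg *.
set D := ~` _ in oD dD.
have finD x : D x -> [/\ lo (f x) \is a fin_num, hi (f x) \is a fin_num,
    lo (g x) \is a fin_num & hi (g x) \is a fin_num].
  by move=> /not_orP[/nGammasetP[lf hf] /nGammasetP[lg hg]].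
split=> [fg x Dx|kt].
- have [lk hk] := ominus_fin cf cg Dx; apply/modulus_le => //.
  have osc q e : H_continuous q -> 0 < e -> (forall x, D x -> hi (q x) \is a fin_num) ->
      dense [set z | D z /\ (hi (q z) <= lo (q z) + e%:E)%E].
    move=> Hq e0 qD O [y Oy] oO; have [z [Oz Dz]] := dD O (ex_intro _ y Oy) oO.
    have [||w [Ow Dw] qw] := H_continuous_oscillation Hq (openI oO oD) _ _ e0.
    + by exists z.
    + by move=> w [_ Dw]; exact: qD.
    + by exists w.
  split.
    apply/lee_addgt0Pr => e e0.
    have dg : dense [set z | D z /\ (hi (g z) <= lo (g z) + e%:E)%E].
      by apply: osc => // z /finD[].
    apply: (H_continuous_le (H_continuous_cst (- t)) Hk dg) => z [Dz gz].
    have [kz _] := kfg z Dz; have [fz1 fz2 gz1 gz2] := finD z Dz.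
    have [_ gf] := fg z; have kz' := ival_le (k z).
    move: kz kz' gf gz; rewrite /=.
    case: (lo (f z)) fz1 => // a _; case: (lo (g z)) gz1 => // b _.
    case: (hi (g z)) gz2 => // c _.
    case: (lo (k z)) => [l| |] //; case: (hi (k z)) => [u| |] //=; rewrite ?leey// -!EFinD ?lee_fin.
    by lra.
  apply/lee_addgt0Pr => e e0.
  have df : dense [set z | D z /\ (hi (f z) <= lo (f z) + e%:E)%E].
    by apply: osc => // z /finD[].
  have kt z : (lo (k z) <= t%:E + e%:E)%E.
    apply: (H_continuous_le Hk (H_continuous_cst t) df) => {}z [Dz fz].
    have [_ kz] := kfg z Dz; have [fz1 fz2 gz1 gz2] := finD z Dz.
    have [gf _] := fg z; have kz' := ival_le (k z).
    move: kz kz' gf fz; rewrite /=.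
    case: (lo (f z)) fz1 => // a _; case: (lo (g z)) gz1 => // b _.
    case: (hi (f z)) fz2 => // c _.
    case: (lo (k z)) => [l| |] //; case: (hi (k z)) => [u| |] //=; rewrite ?leNye// -!EFinD ?lee_fin.
    by lra.
  exact: (H_continuous_hi_le Hk (H_continuous_cst t)).
- have main x : D x -> (lo (f x) <= hi (g x) + t%:E /\ lo (g x) <= hi (f x) + t%:E)%E.
    move=> Dx; have [lk hk] := ominus_fin cf cg Dx.
    have /(modulus_le _ lk hk)[tk kt'] := kt x Dx.
    have [k1 k2] := kfg x Dx; have := ival_le (k x).
    rewrite -/k in lk hk.
    have [fz1 fz2 gz1 gz2] := finD x Dx; move: tk kt' k1 k2.
    case: (lo (f x)) fz1 => // a _; case: (lo (g x)) gz1 => // b _.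
    case: (hi (f x)) fz2 => // c _; case: (hi (g x)) gz2 => // d _.
    case: (lo (k x)) lk => // l _; case: (hi (k x)) hk => // u _.
    by rewrite -!EFinD !lee_fin; lra.
  move=> x; split.
    by apply: (H_continuous_le Hf Hg dD) => z /main[].
  by apply: (H_continuous_le Hg Hf dD) => z /main[].
Qed.

Lemma frac_le (s t : R) : 0 <= s -> 0 <= t -> (s / (1 + s) <= t / (1 + t)) = (s <= t).
Proof.
move=> s0 t0; rewrite ler_pdivrMr ?ltr_pwDl// mulrAC ler_pdivlMr ?ltr_pwDl//.
by rewrite !mulrDr !mulr1 (mulrC s) lerD2r.
Qed.

Lemma rhoP f g t : Hnf X R f -> Hnf X R g -> 0 <= t ->
  rho f g <= t / (1 + t) <-> unif_close t f g.
Proof.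
move=> nf ng t0; rewrite (unif_close_modulus _ nf ng) /rho; set D := ~` _.
set E := [set _ | _ in D].
have fracE x : D x -> E (fine (modulus (ominus f g x)) / (1 + fine (modulus (ominus f g x)))).
  by move=> Dx; exists x.
split=> [Et x Dx|kt]; last first.
  have [->|/set0P E0] := eqVneq E set0; first by rewrite sup0 divr_ge0 ?addr_ge0.
  apply: ge_sup => // _ [x Dx <-].
  by rewrite frac_le ?modulus_ge0//; exact: kt.
rewrite -frac_le ?modulus_ge0//; apply: le_trans Et.
apply: sup_ubound; last exact: fracE.
exists 1 => _ [z _ <-].
by rewrite ler_pdivrMr ?ltr_pwDl ?modulus_ge0// mul1r lerDr.
Qed.

Lemma rho_ge0 f g : 0 <= rho f g.
Proof.
rewrite /rho; set E := [set _ | _ in _].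
have [->|/set0P[y Ey]] := eqVneq E set0; first by rewrite sup0.
have Ey0 : 0 <= y by case: Ey => x _ <-; rewrite divr_ge0 ?addr_ge0 ?modulus_ge0.
apply: (le_trans Ey0); apply: sup_ubound => //; exists 1 => _ [z _ <-].
by rewrite ler_pdivrMr ?ltr_pwDl ?modulus_ge0// mul1r lerDr.
Qed.

Lemma rho_le1 f g : rho f g <= 1.
Proof.
rewrite /rho; set E := [set _ | _ in _].
have [->|/set0P E0] := eqVneq E set0; first by rewrite sup0.
apply: ge_sup => // _ [x Dx <-].
by rewrite ler_pdivrMr ?ltr_pwDl ?modulus_ge0// mul1r lerDr.
Qed.

Lemma rho_close f g : Hnf X R f -> Hnf X R g -> rho f g < 1 ->
  exists t, [/\ 0 <= t, rho f g = t / (1 + t) & unif_close t f g].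
Proof.
move=> nf ng fg1; pose t := rho f g / (1 - rho f g).
have t0 : 0 <= t by rewrite divr_ge0 ?rho_ge0// subr_ge0 ltW.
have tE : rho f g = t / (1 + t).
  by rewrite /t; field; rewrite ?subr_eq0 ?(gt_eqF fg1)//=; rewrite subrK oner_eq0.
by exists t; split => //; apply/rhoP => //; rewrite -tE.
Qed.

Lemma unif_closeC t f g : unif_close t f g -> unif_close t g f.
Proof. by move=> fg x; have [] := fg x. Qed.

Lemma unif_close_trans s t f g h : unif_close s f g -> unif_close t g h -> unif_close (s + t) f h.
Proof.
move=> fg gh x; have [fg1 fg2] := fg x; have [gh1 gh2] := gh x; split.
  by apply: (le_trans fg1); rewrite [(s + t)%R]addrC EFinD addeA leeD2r.
by apply: (le_trans gh2); rewrite EFinD addeA leeD2r.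
Qed.

Lemma unif_closexx f : unif_close 0 f f.
Proof. by move=> x; rewrite adde0. Qed.

Lemma unif_close0_eq f g : H_continuous f -> H_continuous g -> unif_close 0 f g -> f = g.
Proof.
move=> Hf Hg fg; have dT : dense [set: X] by move=> O [x Ox] _; exists x.
apply: (H_continuous_eq Hf Hg dT) => x _; have [] := fg x; rewrite !adde0 => fgx gfx.
  exact: le_trans fgx (ival_le _).
exact: le_trans gfx (ival_le _).
Qed.

Lemma rho_metric : is_metric (@rho_nf X R).
Proof.
have P (f : Hnf X R) : Hnf X R (\val f) by exact: set_valP.
have sym (f g : Hnf X R) : rho_nf f g <= rho_nf g f.
  have [/(rho_close (P g) (P f))[t [t0 gf tc]]|] := ltP (rho_nf g f) 1.
    by rewrite [leRHS]gf; apply/rhoP => //; exact: unif_closeC.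
  by apply: le_trans; exact: rho_le1.
split.
- by move=> f g; exact: rho_ge0.
- move=> f g; split=> [fg0|->]; last first.
    apply/eqP; rewrite eq_le rho_ge0 andbT.
    by have /(rhoP (P g) (P g) (lexx 0)) := unif_closexx (\val g); rewrite mul0r.
  have Hf : H_continuous (\val f) by case: (P f).
  have Hg : H_continuous (\val g) by case: (P g).
  apply: val_inj; apply: unif_close0_eq => //.
  by apply/rhoP => //; rewrite mul0r -[leLHS]/(rho_nf f g) fg0.
- by move=> f g; apply/eqP; rewrite eq_le; apply/andP; split; exact: sym.
- move=> f g h.
  have [fg1|fg1] := leP 1 (rho_nf f g).
    by apply: (le_trans (rho_le1 _ _)); rewrite (le_trans fg1)// lerDl rho_ge0.
  have [gh1|gh1] := leP 1 (rho_nf g h).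
    by apply: (le_trans (rho_le1 _ _)); rewrite (le_trans gh1)// lerDr rho_ge0.
  have [s [s0 fg cfg]] := rho_close (P f) (P g) fg1.
  have [t [t0 gh cgh]] := rho_close (P g) (P h) gh1.
  have /(rhoP (P f) (P h) (addr_ge0 s0 t0)) := unif_close_trans cfg cgh.
  move=> /le_trans; apply; rewrite [rho_nf f g]fg [rho_nf g h]gh mulrDl.
  have le_den (a b : R) : 0 <= a -> 0 <= b -> a / (1 + (a + b)) <= a / (1 + a).
    move=> a0 b0; rewrite ler_wpM2l// lef_pV2 ?posrE ?ltr_pwDl ?addr_ge0//.
    by rewrite addrA lerDl.
  by rewrite lerD ?le_den// addrC [(s + t)%R]addrC addrC le_den.
Qed.

(** The limit is found inside the intersection of the enlarged functions
    [lo u_m - e, hi u_m + e]: a supremum of lower semicontinuous functions is lower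
    semicontinuous, and any two of these intervals meet. *)
Lemma rho_complete : metric_complete (@rho_nf X R).
Proof.
move=> u u_cauchy.
have P (f : Hnf X R) : Hnf X R (\val f) by exact: set_valP.
have Hu n : H_continuous (\val (u n)) by case: (P (u n)).
have lu n : lsc (fun x => lo (\val (u n) x)).
  by have [/S_continuousP[]] := Hu n.
have uu n : usc (fun x => hi (\val (u n) x)).
  by have [/S_continuousP[]] := Hu n.
have frac_gt0 e : 0 < e -> 0 < e / (1 + e) by move=> e0; rewrite divr_gt0// ltr_pwDl// ltW.
(* the pairs (m, e) such that the sequence stays within e of its m-th term *)
pose tail : set (nat * R) := [set me | forall n, (me.1 <= n)%N ->
  unif_close me.2 (\val (u me.1)) (\val (u n))].
have tailP e : 0 < e -> exists N, forall n, (N <= n)%N -> tail (n, e).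
  move=> e0; have [N uN] := u_cauchy _ (frac_gt0 _ e0); exists N => m Nm n /= mn /=.
  apply/(rhoP (P _) (P _) (ltW e0)); apply/ltW/uN => //; exact: leq_trans mn.
have tail_le m e m' e' x : tail (m, e) -> tail (m', e') ->
    (lo (\val (u m) x) - e%:E <= hi (\val (u m') x) + e'%:E)%E.
  move=> me me'; set n := maxn m m'.
  have cm : unif_close e (\val (u m)) (\val (u n)) by apply: me; rewrite /= leq_maxl.
  have cm' : unif_close e' (\val (u n)) (\val (u m')).
    by apply: unif_closeC; apply: me'; rewrite /= leq_maxr.
  rewrite leeBlDr//; apply: (le_trans (cm x).1); rewrite leeD2r//.
  apply: (le_trans (ival_le _)).
  by apply: (H_continuous_hi_le (Hu n) (Hu m')) => z; have [] := cm' z.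
pose L x := ereal_sup [set (lo (\val (u me.1) x) - me.2%:E)%E | me in tail].
pose H x := ereal_inf [set (hi (\val (u me.1) x) + me.2%:E)%E | me in tail].
have LH x : (L x <= H x)%E.
  apply: ge_ereal_sup => _ [[m e] me <-]; apply: le_ereal_inf_tmp => _ [[m' e'] me' <-].
  exact: tail_le.
pose G x := @Ival R (_, _) (LH x).
have cG : S_continuous G.
  apply/S_continuousP; split => c.
    rewrite (_ : [set x | _] = \bigcup_(me in tail)
        [set x | (c + me.2%:E < lo (\val (u me.1) x))%E]).
      by apply: bigcup_open => me _; exact: lu.
    apply/seteqP; split => x /=.
      by move=> /ereal_sup_gt[_ [me tme <-] cme]; exists me => //=; rewrite -lteBrDr.
    move=> [me tme /= cme]; rewrite /lo /= /L.
    apply: (@lt_le_trans _ _ (lo (\val (u me.1) x) - me.2%:E)%E); first by rewrite lteBrDr.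
    by apply: ereal_sup_ubound; exists me.
  rewrite (_ : [set x | _] = \bigcup_(me in tail)
      [set x | (hi (\val (u me.1) x) < c - me.2%:E)%E]).
    by apply: bigcup_open => me _; exact: uu.
  apply/seteqP; split => x /=.
    by move=> /ereal_inf_lt[_ [me tme <-] cme]; exists me => //; move: cme; rewrite -lteBrDr.
  move=> [me tme cme]; have {}cme : (hi (\val (u me.1) x) + me.2%:E < c)%E.
    by rewrite -lteBrDr.
  rewrite /hi /= /H.
  apply: (@le_lt_trans _ _ (hi (\val (u me.1) x) + me.2%:E)%E); last exact: cme.
  by apply: ereal_inf_lbound; exists me.
have [h [Hh hG]] := H_continuous_inside cG.
have h_bnd m e x : tail (m, e) ->
    (lo (\val (u m) x) - e%:E <= lo (h x) /\ hi (h x) <= hi (\val (u m) x) + e%:E)%E.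
  move=> me; have /subset_isetP[Lh hH] := hG x; split.
    by apply: le_trans Lh; apply: ereal_sup_ubound; exists (m, e).
  by apply: (le_trans hH); apply: ereal_inf_lbound; exists (m, e).
have dT : dense [set: X] by move=> O [x Ox] _; exists x.
have h_close m e : tail (m, e) -> unif_close e (\val (u m)) h.
  move=> me x; split; first by rewrite -leeBlDr//; exact: (h_bnd _ _ x me).1.
  apply: (H_continuous_le Hh (Hu m) dT) => z _.
  by apply: (le_trans (ival_le _)); exact: (h_bnd _ _ z me).2.
have nh : Hnf X R h.
  split => //; first by apply: Gammaset_closed; case: Hh.
  have [N /(_ N (leqnn N)) tN] := tailP 1 ltr01.
  have [_ _] := P (u N); apply: nowhere_denseS => x; apply: contraPP.
  move=> /nGammasetP[lN hN]; apply/nGammasetP.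
  have [lNh hhN] := h_bnd _ _ x tN; have lh := ival_le (h x).
  have l : (-oo < lo (h x))%E.
    by apply: lt_le_trans lNh; rewrite ltNye_eq fin_numB lN.
  have h' : (hi (h x) < +oo)%E.
    by apply: le_lt_trans hhN _; rewrite ltey_eq fin_numD hN.
  by rewrite !fin_numElt l h' (lt_le_trans l lh) (le_lt_trans lh h').
exists (exist _ h (mem_set nh)) => e e0.
have [e1|e1] := ltP 1 e.
  by exists 0%N => n _; apply: le_lt_trans e1; exact: rho_le1.
have [N tN] := tailP (e / 2) (divr_gt0 e0 (ltr0Sn _ 1)).
exists N => n /tN /h_close un; apply: (@le_lt_trans _ _ (e / 2 / (1 + e / 2))).
  by apply/rhoP => //; rewrite divr_ge0// ltW.
have e20 : 0 < e / 2 by rewrite divr_gt0.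
rewrite ltr_pdivrMr ?ltr_pwDl ?ltW//; nra.
Qed.

End Metric.

(** * Functions that are real and continuous on a dense open set *)

Section NearlyDefined.
Context {X : topologicalType} {R : realType}.
Implicit Types (f g h : X -> ival R) (v w : X -> R) (D : set X).

Lemma H_continuous_hull D v : open D -> (forall x, D x -> {for x, continuous v}) ->
  exists h, H_continuous h /\ forall x, D x -> h x = ipt (v x)%:E.
Proof.
move=> oD cv.
(* outside of D the interval is the whole extended line, which is compatible
   with S-continuity because D is open *)
pose l x : \bar R := if x \in D then (v x)%:E else -oo%E.
pose u x : \bar R := if x \in D then (v x)%:E else +oo%E.
have lu x : (l x <= u x)%E by rewrite /l /u; case: ifP => // _; exact: leNye.
pose G x := @Ival R (l x, u x) (lu x).
have cG : S_continuous G.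
  apply/S_continuousP; split => c; rewrite openE => x; rewrite /mkset /interior.
    have [/set_mem Dx|Dx] := boolP (x \in D); last first.
      by rewrite [lo _]/(l x) /l (negbTE Dx) ltNge leNye.
    rewrite [lo _]/(l x) /l mem_set// => cvx.
    have xD : \forall z \near x, D z by apply: open_nbhs_nbhs.
    have : \forall z \near x, (c < (v z)%:E)%E.
      case: c cvx => [c| |] //; first by rewrite lte_fin; exact: (cvgr_gt _ (cv x Dx)).
      by move=> _; apply: nearW => z; exact: ltNyr.
    by apply: filterS2 xD => z Dz; rewrite /lo /= /l mem_set.
  have [/set_mem Dx|Dx] := boolP (x \in D); last first.
    by rewrite [hi _]/(u x) /u (negbTE Dx) ltNge leey.
  rewrite [hi _]/(u x) /u mem_set// => cvx.
  have xD : \forall z \near x, D z by apply: open_nbhs_nbhs.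
  have : \forall z \near x, ((v z)%:E < c)%E.
    case: c cvx => [c| |] //; first by rewrite lte_fin; exact: (cvgr_lt _ (cv x Dx)).
    by move=> _; apply: nearW => z; exact: ltry.
  by apply: filterS2 xD => z Dz; rewrite /hi /= /u mem_set.
have [h [Hh hG]] := H_continuous_inside cG; exists h; split => // x Dx.
have /subset_isetP := hG x; rewrite [lo (G x)]/(l x) [hi (G x)]/(u x) /l /u mem_set// => -[l1 u1].
have lh := ival_le (h x).
apply: ival_eq; apply/eqP; rewrite eq_le ?l1 ?u1 ?andbT /=.
  exact: le_trans lh u1.
exact: le_trans l1 lh.
Qed.

Definition represents f v :=
  exists D, [/\ open D, dense D & forall x, D x -> f x = ipt (v x)%:E].

Lemma represents_Hnd f v : H_continuous f -> represents f v -> Hnd X R f.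
Proof.
move=> Hf [D [oD dD fD]]; split; [split=> //|].
- by apply: Gammaset_closed; case: Hf.
- apply: nowhere_denseS (open_dense_nowhere_dense oD dD) => x; apply: contraPP.
  by move=> /contrapT /fD fx; apply/nGammasetP; rewrite fx.
- rewrite /nowhere_dense -(closure_id _).1; last exact: closed_closure.
  apply: nowhere_denseS (open_dense_nowhere_dense oD dD) => x; apply: contraPP.
  by move=> /contrapT /fD fx; rewrite /Wset /= fx /width /= subrr ltxx.
Qed.

Lemma width0_ipt (A : ival R) : lo A \is a fin_num -> hi A \is a fin_num ->
  ~ (0 < width A)%E -> A = ipt (fine (lo A))%:E.
Proof.
rewrite /width; have := ival_le A.
case lA : (lo A) => [a| |] //; case hA : (hi A) => [b| |] //= ab _ _.
rewrite lte_fin subr_gt0 => /negP; rewrite -leNgt => ba; rewrite lee_fin in ab.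
by apply: ival_eq; rewrite ?lA ?hA//; congr (_%:E); apply/eqP; rewrite eq_le ab ba.
Qed.

Definition ival_fun f x : R := fine (lo (f x)).

(** Off the closure of the points with a wide or an infinite value, a lower and an
    upper semicontinuous function coincide. *)
Lemma Hnd_represents f : Hnd X R f -> exists D,
  [/\ open D, dense D, forall x, D x -> f x = ipt (ival_fun f x)%:E
    & forall x, D x -> {for x, continuous (ival_fun f)}].
Proof.
move=> [[Hf cG nG] nW]; have [cf _] := Hf.
pose D := ~` Gammaset f `&` ~` closure (Wset f).
have oD : open D by apply: openI; rewrite openC//; exact: closed_closure.
have fD x : D x -> f x = ipt (ival_fun f x)%:E.
  move=> [/nGammasetP[lf hf] nWx].
  by apply: width0_ipt => // Wx; exact/nWx/subset_closure.
exists D; split => //.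
  apply: denseI; [by rewrite openC|exact: closed_nowhere_dense|].
  exact: (closed_nowhere_dense (@closed_closure _ _)).
move=> x Dx; apply/cvgrPdist_lt => e e0.
have /S_continuousP[lf uf] := cf.
have xD : \forall z \near x, D z by apply: open_nbhs_nbhs.
have xl : \forall z \near x, ((ival_fun f x - e)%:E < lo (f z))%E.
  apply: open_nbhs_nbhs; split; first exact: lf.
  by rewrite /= (fD _ Dx) lte_fin gtrDl oppr_lt0.
have xu : \forall z \near x, (hi (f z) < (ival_fun f x + e)%:E)%E.
  apply: open_nbhs_nbhs; split; first exact: uf.
  by rewrite /= (fD _ Dx) lte_fin ltrDl.
near=> z; have Dz : D z by near: z.
have : ((ival_fun f x - e)%:E < lo (f z))%E by near: z.
have : (hi (f z) < (ival_fun f x + e)%:E)%E by near: z.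
rewrite (fD _ Dz) /= !lte_fin => z1 z2.
by rewrite distrC ltr_distl z2 z1.
Unshelve. all: by end_near. Qed.

Lemma represents_uniq f g v w D : H_continuous f -> H_continuous g ->
  represents f v -> represents g w -> open D -> dense D -> {in D, v =1 w} -> f = g.
Proof.
move=> Hf Hg [Df [odf df fD]] [Dg [odg dg gD]] oD dD vw.
have dfg : dense (D `&` (Df `&` Dg)) by apply: denseI => //; exact: denseI.
apply: (H_continuous_eq Hf Hg dfg) => x [Dx [/fD -> /gD ->]] /=; by rewrite vw// inE.
Qed.

Lemma represents_oplus f g v w : S_continuous f -> S_continuous g ->
  represents f v -> represents g w -> represents (oplus f g) (fun x => v x + w x).
Proof.
move=> cf cg [Df [odf df fD]] [Dg [odg dg gD]].
exists (Df `&` Dg); split; [exact: openI|exact: denseI|move=> x [/fD fx /gD gx]].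
have [_ /(_ x)] := oplusP cf cg; rewrite fx gx => sub.
have bnd y : iset (oplus f g x) y -> y = (v x + w x)%:E.
  move=> /sub[a /= /andP[a1 a2] [b /andP[b1 b2]]].
  have -> : a = (v x)%:E by apply/eqP; rewrite eq_le a1 a2.
  by have -> : b = (w x)%:E by apply/eqP; rewrite eq_le b1 b2.
by apply: ival_eq; apply: bnd; [exact: iset_lo|exact: iset_hi].
Qed.

Lemma represents_otimes f g v w : S_continuous f -> S_continuous g ->
  represents f v -> represents g w -> represents (otimes f g) (fun x => v x * w x).
Proof.
move=> cf cg [Df [odf df fD]] [Dg [odg dg gD]].
exists (Df `&` Dg); split; [exact: openI|exact: denseI|move=> x [/fD fx /gD gx]].
have [_ /(_ x)] := otimesP cf cg; rewrite fx gx => sub.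
have bnd y : iset (otimes f g x) y -> y = (v x * w x)%:E.
  move=> /sub[a /= /andP[a1 a2] [b /andP[b1 b2]]].
  have -> : a = (v x)%:E by apply/eqP; rewrite eq_le a1 a2.
  have -> : b = (w x)%:E by apply/eqP; rewrite eq_le b1 b2.
  by rewrite /emul_set /= !andbF.
by apply: ival_eq; apply: bnd; [exact: iset_lo|exact: iset_hi].
Qed.

(** Rounding [lo f] down to a multiple of e.  On an open set where f is bounded
    above, the rounded function attains a largest value, on an open subset since
    [lo f] is lower semicontinuous; so it is locally constant on a dense open set. *)
Lemma Hnd_approximation f e : Hnf X R f -> 0 < e -> exists g, Hnd X R g /\ unif_close e f g.
Proof.
move=> nf e0; have [Hf cG nG] := nf; have [cf _] := Hf.
have /S_continuousP[lf uf] := cf.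
(* the largest multiple of e strictly below f; strictness makes the
   set of points where v is at least a given multiple of e open *)
pose v x : R := e * (Num.ceil (ival_fun f x / e) - 1)%:~R.
have v_itv x : v x < ival_fun f x <= v x + e.
  have /andP[] := ceil_itv (ival_fun f x / e); rewrite /v.
  rewrite ltr_pdivlMr// ler_pdivrMr// => h1 h2; rewrite mulrC h1 /=.
  by move: h2; rewrite intrD; lra.
pose D := ~` Gammaset f `&` \bigcup_r interior [set z | v z = r].
have oD : open D.
  apply: openI; first by rewrite openC.
  by apply: bigcup_open => r _; exact: open_interior.
have cv x : D x -> {for x, continuous v}.
  move=> [_ [r _ xr]].
  have vx : v x = r by exact: (nbhs_singleton xr).
  rewrite /prop_for /continuous_at vx.
  by apply: cvg_near_cst.
have dD : dense D.
  move=> O O0 oO; have dG := closed_nowhere_dense cG nG.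
  have [x [Ox Gx]] := dG O O0 oO; have /nGammasetP[_ hfin] := Gx.
  pose M := fine (hi (f x)) + 1.
  pose V := O `&` ~` Gammaset f `&` [set z | (hi (f z) < M%:E)%E].
  have oV : open V by apply: openI; [apply: openI; rewrite ?openC|exact: uf].
  have Vx : V x by split=> //=; rewrite -(fineK hfin) lte_fin ltrDl.
  have Vfin z : V z -> lo (f z) = (ival_fun f z)%:E.
    by move=> [[_ /nGammasetP[? _]] _]; rewrite fineK.
  pose S := [set ival_fun f z | z in V].
  have S0 : S !=set0 by exists (ival_fun f x), x.
  have Sub : has_ubound S.
    exists M => _ [z Vz <-]; rewrite -lee_fin -Vfin//.
    by apply: (le_trans (ival_le _)); apply: ltW; case: Vz.
  (* the values of v on V are at most r, and r is attained since r < sup S *)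
  pose r := e * (Num.ceil (sup S / e) - 1)%:~R.
  have /andP[r1 r2] := ceil_itv (sup S / e).
  have rS : r < sup S by rewrite /r mulrC -ltr_pdivlMr.
  have [_ [z Vz <-] rz] := sup_gt S0 rS.
  pose W := V `&` [set y | (r%:E < lo (f y))%E].
  have vW y : W y -> v y = r.
    move=> [Vy ry]; rewrite /v /r; congr (_ * (_ - 1)%:~R); apply: ceil_def.
    rewrite /mkset Vfin// lte_fin /r mulrC -ltr_pdivlMr// in ry; rewrite ry /=.
    apply: le_trans r2; rewrite ler_pM2r ?invr_gt0//.
    by apply: sup_ubound => //; exists y.
  have oW : open W by apply: openI; [|exact: lf].
  exists z; case: (Vz) => -[Oz Gz] _; split => //; split => //.
  exists r => //; apply: (filterS vW); apply: open_nbhs_nbhs; split => //.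
  by split=> //; rewrite /mkset Vfin// lte_fin.
have [g [Hg gD]] := H_continuous_hull oD cv.
have repg : represents g v by exists D.
exists g; split; first exact: represents_Hnd repg.
have fD x : D x -> lo (f x) = (ival_fun f x)%:E.
  by move=> [/nGammasetP[? _] _]; rewrite fineK.
move=> x; split.
  apply: (H_continuous_le Hf Hg dD) => z Dz; rewrite (gD _ Dz) fD// lee_fin.
  by have /andP[] := v_itv z.
apply: (H_continuous_le Hg Hf dD) => z Dz; rewrite (gD _ Dz).
apply: (@le_trans _ _ (lo (f z) + e%:E)%E); last by rewrite leeD2r// ival_le.
rewrite fD// lee_fin; have /andP[+ _] := v_itv z; rewrite /=; move: e0; lra.
Qed.

End NearlyDefined.

(** * The ring Hnd *)

Section NearlyDefinedRing.
Context {X : topologicalType} {R : realType}.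

Record Hnd_ring := HndRing { nd_val :> X -> ival R; nd_Hnd : Hnd X R nd_val }.

HB.instance Definition _ := gen_eqMixin Hnd_ring.
HB.instance Definition _ := gen_choiceMixin Hnd_ring.

Implicit Types (f g h : Hnd_ring) (v w : X -> R).

Lemma nd_val_inj f g : (f : X -> ival R) = g -> f = g.
Proof. by case: f g => [f Pf] [g Pg] /= fg; subst g; congr HndRing; exact: Prop_irrelevance. Qed.

Lemma nd_H_continuous f : H_continuous f.
Proof. by case: (nd_Hnd f) => -[]. Qed.

Lemma nd_S_continuous f : S_continuous f.
Proof. by case: (nd_H_continuous f). Qed.

Lemma nd_represents f : represents f (ival_fun f).
Proof. by have [D [? ? ? _]] := Hnd_represents (nd_Hnd f); exists D. Qed.

(** The ring axioms reduce to identities between real functions by this lemma: both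
    sides are H-continuous and agree on a dense open set. *)
Lemma nd_eq_on (D : set X) f g v w : open D -> dense D -> {in D, v =1 w} ->
  represents f v -> represents g w -> f = g.
Proof.
move=> oD dD vw fv gw; apply: nd_val_inj.
exact: (represents_uniq (nd_H_continuous f) (nd_H_continuous g) fv gw oD dD vw).
Qed.

Lemma nd_eq f g v w : v =1 w -> represents f v -> represents g w -> f = g.
Proof.
move=> vw; apply: (@nd_eq_on setT) => //; first exact: openT.
by move=> O [x Ox] _; exists x.
Qed.

Lemma nd_hull (D : set X) v : open D -> dense D ->
  (forall x, D x -> {for x, continuous v}) -> exists f, represents f v.
Proof.
move=> oD dD cv; have [h [Hh hD]] := H_continuous_hull oD cv.
have hv : represents h v by exists D.
by exists (HndRing (represents_Hnd Hh hv)).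
Qed.

Lemma represents_of_cts (u : continuousType X R) : represents (of_cts u) u.
Proof.
exists setT; split=> //; first exact: openT.
by move=> O [x Ox] _; exists x.
Qed.

Lemma Hnd_of_cts (u : continuousType X R) : Hnd X R (of_cts u).
Proof.
have [h [Hh hu]] := @H_continuous_hull X R setT u (@openT _) (fun x _ => @cts_fun _ _ u x).
have <- : h = of_cts u by apply/funext => x; rewrite hu.
by apply: (represents_Hnd Hh (v := u)); exists setT; split=> //;
  [exact: openT|move=> O [x Ox] _; exists x].
Qed.

Definition nd_of_cts u := HndRing (Hnd_of_cts u).

Lemma nd_of_ctsP u : represents (nd_of_cts u) u.
Proof. exact: represents_of_cts. Qed.

Lemma nd_add_subproof f g : Hnd X R (oplus f g).
Proof.
have [cf cg] := (@nd_S_continuous f, @nd_S_continuous g).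
apply: represents_Hnd (represents_oplus cf cg (nd_represents f) (nd_represents g)).
by case: (oplusP cf cg).
Qed.

Lemma nd_mul_subproof f g : Hnd X R (otimes f g).
Proof.
have [cf cg] := (@nd_S_continuous f, @nd_S_continuous g).
apply: represents_Hnd (represents_otimes cf cg (nd_represents f) (nd_represents g)).
by case: (otimesP cf cg).
Qed.

Definition nd_add f g := HndRing (nd_add_subproof f g).
Definition nd_mul f g := HndRing (nd_mul_subproof f g).
Definition nd_zero := nd_of_cts 0.
Definition nd_one := nd_of_cts 1.
Definition nd_opp f := nd_mul (nd_of_cts (-1)) f.

Lemma nd_addP f g v w : represents f v -> represents g w ->
  represents (nd_add f g) (fun x => v x + w x).
Proof. exact: represents_oplus (@nd_S_continuous f) (@nd_S_continuous g). Qed.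

Lemma nd_mulP f g v w : represents f v -> represents g w ->
  represents (nd_mul f g) (fun x => v x * w x).
Proof. exact: represents_otimes (@nd_S_continuous f) (@nd_S_continuous g). Qed.

Lemma nd_addA : associative nd_add.
Proof.
move=> f g h; have [F [G H]] := (nd_represents f, (nd_represents g, nd_represents h)).
by apply: (nd_eq _ (nd_addP F (nd_addP G H)) (nd_addP (nd_addP F G) H)) => x; rewrite addrA.
Qed.

Lemma nd_addC : commutative nd_add.
Proof.
move=> f g; have [F G] := (nd_represents f, nd_represents g).
by apply: (nd_eq _ (nd_addP F G) (nd_addP G F)) => x; rewrite addrC.
Qed.

Lemma nd_add0 : left_id nd_zero nd_add.
Proof.
move=> f; have F := nd_represents f.
by apply: (nd_eq _ (nd_addP (nd_of_ctsP 0) F) F) => x; rewrite add0r.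
Qed.

Lemma nd_addN : left_inverse nd_zero nd_opp nd_add.
Proof.
move=> f; have F := nd_represents f.
apply: (nd_eq _ (nd_addP (nd_mulP (nd_of_ctsP (-1)) F) F) (nd_of_ctsP 0)) => x.
by rewrite mulN1r addNr.
Qed.

HB.instance Definition _ := GRing.isZmodule.Build Hnd_ring nd_addA nd_addC nd_add0 nd_addN.

Lemma nd_mulA : associative nd_mul.
Proof.
move=> f g h; have [F [G H]] := (nd_represents f, (nd_represents g, nd_represents h)).
by apply: (nd_eq _ (nd_mulP F (nd_mulP G H)) (nd_mulP (nd_mulP F G) H)) => x; rewrite mulrA.
Qed.

Lemma nd_mulC : commutative nd_mul.
Proof.
move=> f g; have [F G] := (nd_represents f, nd_represents g).
by apply: (nd_eq _ (nd_mulP F G) (nd_mulP G F)) => x; rewrite mulrC.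
Qed.

Lemma nd_mul1 : left_id nd_one nd_mul.
Proof.
move=> f; have F := nd_represents f.
by apply: (nd_eq _ (nd_mulP (nd_of_ctsP 1) F) F) => x; rewrite mul1r.
Qed.

Lemma nd_mulDl : left_distributive nd_mul nd_add.
Proof.
move=> f g h; have [F [G H]] := (nd_represents f, (nd_represents g, nd_represents h)).
by apply: (nd_eq _ (nd_mulP (nd_addP F G) H) (nd_addP (nd_mulP F H) (nd_mulP G H))) => x;
  rewrite mulrDl.
Qed.

HB.instance Definition _ :=
  GRing.Zmodule_isComPzRing.Build Hnd_ring nd_mulA nd_mulC nd_mul1 nd_mulDl.

Lemma nd_of_cts_nmod : nmod_morphism nd_of_cts.
Proof.
split=> // u v.
by apply: (nd_eq _ (nd_of_ctsP _) (nd_addP (nd_of_ctsP u) (nd_of_ctsP v))).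
Qed.

Lemma nd_of_cts_monoid : monoid_morphism nd_of_cts.
Proof.
split=> // u v.
by apply: (nd_eq _ (nd_of_ctsP _) (nd_mulP (nd_of_ctsP u) (nd_of_ctsP v))).
Qed.

HB.instance Definition _ := GRing.isNmodMorphism.Build _ _ nd_of_cts nd_of_cts_nmod.
HB.instance Definition _ := GRing.isMonoidMorphism.Build _ _ nd_of_cts nd_of_cts_monoid.

Definition nd_incl : {rmorphism continuousType X R -> Hnd_ring} := nd_of_cts.

Lemma nd_incl_inj : injective nd_incl.
Proof.
move=> u v /(congr1 nd_val) uv; apply/continuousEP => x.
by have := congr1 (fun F => fine (lo (F x))) uv.
Qed.

Lemma represents_eq_near f v w x : represents f v -> represents f w ->
  (forall O, open O -> O x -> exists y, O y /\ v y = w y).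
Proof.
move=> [D [oD dD fv]] [E [oE dE fw]] O oO Ox.
have [y [Oy [Dy Ey]]] := denseI oD dD dE (ex_intro _ x Ox) oO.
exists y; split => //.
by have := fv y Dy; rewrite (fw y Ey) => /(congr1 (fun A => fine (lo A))).
Qed.

End NearlyDefinedRing.
Arguments Hnd_ring X R : clear implicits.

(** * Hnd is the maximal ring of quotients of C(X) *)

Section RationalExtension.
Context {X : topologicalType} {R : realType}.
Hypothesis hX : completely_regular_space X.

Lemma cts_bump (O : set X) x : open O -> O x ->
  exists a : continuousType X R, a x = 1 /\ forall y, ~ O y -> a y = 0.
Proof.
move=> oO Ox; have xO : uniform_separator [set x] (~` O).
  by apply: hX; [rewrite closedC|exact].
have [q [cq _ q0 q1]] := (@uniform_separatorP _ R _ _).1 xO.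
have c1q : continuous (fun y => 1 - q y).
  by move=> y; apply: cvgB; [exact: cvg_cst|exact: cq].
exists (mkcts c1q); split=> [|y nOy].
  by rewrite -[LHS]/(1 - q x) (q0 (q x)) ?subr0//; exists x.
by rewrite -[LHS]/(1 - q y) (q1 (q y)) ?subrr//; exists y.
Qed.

Lemma cts_neq0_open (a : continuousType X R) : open [set x | a x != 0].
Proof.
by apply: (@open_comp _ _ a [set y | y != 0]) => [x _|]; [exact: cts_fun|exact: open_neq].
Qed.

(** If c does not vanish at x, multiply b by a bump a at x supported where b is
    bounded: b a is continuous, yet c a is not zero near x. *)
Lemma nd_incl_rational : rational_extension (@nd_incl X R).
Proof.
split; first exact: nd_incl_inj.
move=> b c bc.
have [Db [odb ddb bD cb]] := Hnd_represents (nd_Hnd b).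
have [Dc [odc ddc cD cc]] := Hnd_represents (nd_Hnd c).
have oD : open (Db `&` Dc) by exact: openI.
have dD : dense (Db `&` Dc) by exact: denseI.
apply: (nd_eq_on oD dD _ (nd_represents c) (nd_of_ctsP 0)) => x.
rewrite inE => -[Dbx Dcx]; apply: contrapT => cx0.
pose M := `|ival_fun b x| + 1.
have M0 : 0 < M by rewrite ltr_wpDl.
(* b is bounded on V, so that b times a bump supported in V is continuous
   across the boundary of V *)
pose V := Db `&` interior [set z | `|ival_fun b z| < M].
have oV : open V by apply: openI => //; exact: open_interior.
have Vx : V x.
  split => //; apply: (cvgr_lt `|ival_fun b x|); last by rewrite ltrDl.
  by apply: cvg_norm; exact: cb.
have [a [ax a0]] := cts_bump oV Vx.
pose a' z := ival_fun b z * a z.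
have a'M z : `|a' z| <= M * `|a z|.
  rewrite normrM; have [[_ /interior_subset/= /ltW bz]|/a0 ->] := pselect (V z).
    by rewrite ler_wpM2r.
  by rewrite normr0 !mulr0.
have ca' : continuous a'.
  move=> z; have [[Dbz _]|/a0 az] := pselect (V z).
    by apply: cvgM; [exact: cb|exact: cts_fun].
  have a'z : a' z = 0 by rewrite /a' az mulr0.
  apply/cvgrPdist_lt => e e0.
  have : \forall y \near z, `|a z - a y| < e / M.
    by move/cvgrPdist_lt: (@cts_fun _ _ a z); apply; rewrite divr_gt0.
  apply: filterS => y; rewrite az a'z !sub0r !normrN ltr_pdivlMr// mulrC.
  exact: le_lt_trans (a'M y).
have ba : b * nd_incl a = nd_incl (mkcts ca').
  by apply: (nd_eq _ (nd_mulP (nd_represents b) (nd_of_ctsP a)) (nd_of_ctsP (mkcts ca'))).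
have ca0 := bc a (ex_intro _ _ ba).
have ca_rep : represents (0 : Hnd_ring X R) (fun z => ival_fun c z * a z).
  by rewrite -ca0; exact: nd_mulP (nd_represents c) (nd_of_ctsP a).
have : nbhs x [set z | ival_fun c z * a z != 0].
  have : ival_fun c z * a z @[z --> x] --> ival_fun c x * a x.
    by apply: cvgM; [exact: cc|exact: cts_fun].
  move=> /(_ [set y | y != 0]); apply; apply: open_nbhs_nbhs; split; first exact: open_neq.
  by rewrite /= ax mulr1; apply/eqP.
rewrite nbhsE => -[U [oU Ux] Uca].
have [y [Uy ca0y]] := represents_eq_near ca_rep (nd_of_ctsP 0) oU Ux.
by have := Uca y Uy; rewrite /= ca0y eqxx.
Qed.

Section Universality.
Variables (B : comPzRingType) (j : {rmorphism continuousType X R -> B}).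
Hypothesis j_rat : rational_extension j.
Implicit Types (a : continuousType X R) (b c : B).

Let j_inj : injective j. Proof. by case: j_rat. Qed.

(** The cozero set of the ideal of the a in C(X) with b a in C(X). *)
Definition quot_dom b : set X :=
  [set x | exists a a', b * j a = j a' /\ a x != 0].

(** b as the quotient a' / a, which [quot_funE] shows to be independent of a. *)
Definition quot_fun b x : R :=
  xget 0 [set y | exists a a', [/\ b * j a = j a', a x != 0 & y = a' x / a x]].

Lemma quot_funE b x a a' : b * j a = j a' -> a x != 0 -> quot_fun b x = a' x / a x.
Proof.
move=> ba ax; rewrite /quot_fun; case: xgetP => [_ -> [a1 [a1' [ba1 a1x ->]]]|].
  have /j_inj/(congr1 (fun u : continuousType X R => u x)) : j (a1' * a) = j (a' * a1).
    by rewrite !rmorphM -ba -ba1 mulrAC.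
  by move=> /= E; apply/eqP; rewrite eqr_div//; apply/eqP.
by move=> /(_ (a' x / a x)) []; exists a, a'.
Qed.

Lemma quot_dom_open b : open (quot_dom b).
Proof.
rewrite openE => x [a [a' [ba ax]]].
have : nbhs x [set z | a z != 0] by apply: open_nbhs_nbhs; split => //; exact: cts_neq0_open.
by apply: filterS => z az; exists a, a'.
Qed.

(** A bump supported off this set would annihilate the ideal of denominators of b,
    which rationality excludes. *)
Lemma quot_dom_dense b : dense (quot_dom b).
Proof.
move=> O [x Ox] oO; apply: contrapT => /forallNP Ob.
have [c [cx c0]] := cts_bump oO Ox.
suff c_eq0 : c = 0 by move: cx; rewrite c_eq0 => /esym/eqP; rewrite oner_eq0.
apply: j_inj; rewrite rmorph0; apply: (j_rat.2 b) => a [a' ba].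
rewrite -rmorphM (_ : c * a = 0) ?rmorph0//; apply/continuousEP => y.
change (c y * a y = 0).
have [Oy|/c0 ->] := pselect (O y); last by rewrite mul0r.
have [->|ay] := eqVneq (a y) 0; first by rewrite mulr0.
by case: (Ob y); split => //; exists a, a'.
Qed.

Lemma quot_fun_continuous b x : quot_dom b x -> {for x, continuous (quot_fun b)}.
Proof.
move=> [a [a' [ba ax]]]; rewrite /prop_for /continuous_at (quot_funE ba ax).
have : a' z / a z @[z --> x] --> a' x / a x.
  by apply: cvgM; [exact: cts_fun|apply: cvgV => //; exact: cts_fun].
apply: cvg_trans; apply: near_eq_cvg.
have : nbhs x [set z | a z != 0] by apply: open_nbhs_nbhs; split => //; exact: cts_neq0_open.
by apply: filterS => z az; rewrite (quot_funE ba az).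
Qed.

Lemma quot_nd_exists b : exists f : Hnd_ring X R, represents f (quot_fun b).
Proof. exact: nd_hull (@quot_dom_open b) (@quot_dom_dense b) (@quot_fun_continuous b). Qed.

Definition quot_nd b : Hnd_ring X R := sval (cid (quot_nd_exists b)).

Lemma quot_ndP b : represents (quot_nd b) (quot_fun b).
Proof. exact: svalP (cid (quot_nd_exists b)). Qed.

Lemma quot_nd_incl a : quot_nd (j a) = nd_incl a.
Proof.
apply: (nd_eq _ (quot_ndP _) (nd_of_ctsP a)) => x.
have one_x : (1 : continuousType X R) x != 0 by exact: oner_neq0.
by rewrite (@quot_funE _ _ 1 a) ?rmorph1 ?mulr1//; exact: divr1.
Qed.

Lemma quot_common b c x : quot_dom b x -> quot_dom c x ->
  exists a a1 a2, [/\ a x != 0, b * j a = j a1 & c * j a = j a2].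
Proof.
move=> [a1 [b' [ba a1x]]] [a2 [c' [ca a2x]]].
exists (a1 * a2), (b' * a2), (a1 * c'); split.
- by rewrite mulf_neq0.
- by rewrite !rmorphM mulrA ba.
- by rewrite !rmorphM mulrCA ca.
Qed.

Lemma quot_nd_nmod : nmod_morphism quot_nd.
Proof.
split=> [|b c]; first by rewrite -(rmorph0 j) quot_nd_incl rmorph0.
have oD := openI (@quot_dom_open b) (@quot_dom_open c).
have dD := denseI (@quot_dom_open b) (@quot_dom_dense b) (@quot_dom_dense c).
apply: (nd_eq_on oD dD _ (quot_ndP _) (nd_addP (quot_ndP b) (quot_ndP c))) => x.
rewrite inE => -[/quot_common xb /xb[a [b' [c' [ax ba ca]]]]].
rewrite (quot_funE ba ax) (quot_funE ca ax) -mulrDl.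
by apply: (@quot_funE _ _ a (b' + c')) => //; rewrite mulrDl rmorphD ba ca.
Qed.

Lemma quot_nd_monoid : monoid_morphism quot_nd.
Proof.
split=> [|b c]; first by rewrite -(rmorph1 j) quot_nd_incl rmorph1.
have oD := openI (@quot_dom_open b) (@quot_dom_open c).
have dD := denseI (@quot_dom_open b) (@quot_dom_dense b) (@quot_dom_dense c).
apply: (nd_eq_on oD dD _ (quot_ndP _) (nd_mulP (quot_ndP b) (quot_ndP c))) => x.
rewrite inE => -[/quot_common xb /xb[a [b' [c' [ax ba ca]]]]].
rewrite (quot_funE ba ax) (quot_funE ca ax) mulf_div.
apply: (@quot_funE _ _ (a * a) (b' * c')); last by rewrite mulf_neq0.
by rewrite !rmorphM mulrACA ba ca.
Qed.

HB.instance Definition _ := GRing.isNmodMorphism.Build _ _ quot_nd quot_nd_nmod.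
HB.instance Definition _ := GRing.isMonoidMorphism.Build _ _ quot_nd quot_nd_monoid.

(** If b maps to 0 then so do its numerators, and the denominators annihilate b. *)
Lemma quot_nd_inj : injective quot_nd.
Proof.
apply: raddf_inj => b b0; apply: (j_rat.2 b) => a [a' ba].
suff a'0 : a' = 0 by rewrite ba a'0 rmorph0.
by apply: nd_incl_inj; rewrite -quot_nd_incl -ba rmorphM b0 mul0r rmorph0.
Qed.

Definition quot_morphism : {rmorphism B -> Hnd_ring X R} := quot_nd.

End Universality.

Lemma nd_incl_maximal : maximal_rational_extension (@nd_incl X R).
Proof.
split; first exact: nd_incl_rational.
move=> B j j_rat; exists (quot_morphism j_rat).
by split; [exact: quot_nd_inj|exact: quot_nd_incl].
Qed.

End RationalExtension.

(** * Uniqueness of the maximal ring of quotients, and its completion *)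

(** [h b - b] annihilates the denominators of b. *)
Lemma rational_endo_id (A B : comPzRingType) (i : {rmorphism A -> B})
  (h : {rmorphism B -> B}) : rational_extension i -> (forall a, h (i a) = i a) -> h =1 id.
Proof.
move=> [_ irat] hi b; apply/eqP; rewrite -subr_eq0; apply/eqP/(irat b) => a [a' ba].
by rewrite mulrBl ba -(hi a) -rmorphM ba hi subrr.
Qed.

Lemma maximal_rational_iso (A P Q : comPzRingType) (i : {rmorphism A -> P})
  (j : {rmorphism A -> Q}) : maximal_rational_extension i -> maximal_rational_extension j ->
  exists k : {rmorphism P -> Q}, [/\ injective k, forall q, exists p, k p = q
    & forall a, k (i a) = j a].
Proof.
move=> [irat imax] [jrat jmax]; have [k [k_inj ki]] := jmax _ _ irat.
have [h [h_inj hj]] := imax _ _ jrat; exists k; split => // q; exists (h q).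
by apply: (@rational_endo_id _ _ j (k \o h)) => // a; rewrite /= hj ki.
Qed.

Theorem theorem9 (R : realType) (X : topologicalType)
    (hX : completely_regular_space X)
    (Q : comPzRingType) (i : {rmorphism continuousType X R -> Q})
    (hQ : maximal_rational_extension i) :
  exists phi : Q -> Hnf X R,
    Hnd_identification i phi /\
    is_metric_completion
      (fun p q => rho_nf (phi p) (phi q)) (@rho_nf X R) phi.
Proof.
have [k [k_inj k_surj ki]] := maximal_rational_iso hQ (@nd_incl_maximal X R hX).
have nf (f : Hnd_ring X R) : (f : X -> ival R) \in Hnf X R by apply/mem_set; case: (nd_Hnd f).
pose phi q : Hnf X R := exist _ (k q : X -> ival R) (nf (k q)).
exists phi; split.
  split.
  - by move=> p q /(congr1 val) /= /nd_val_inj/k_inj.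
  - by move=> p q; rewrite /= rmorphD.
  - by move=> p q; rewrite /= rmorphM.
  - by move=> u; rewrite /= ki.
  - apply/seteqP; split=> [_ [q _ <-]|f Hf]; first exact: nd_Hnd.
    by have [q kq] := k_surj (HndRing Hf); exists q; rewrite //= kq.
split => //; [exact: rho_metric|exact: rho_complete|].
move=> y e e0; have P : Hnf X R (\val y) by exact: set_valP.
have [g [Hg gy]] := Hnd_approximation P e0.
have [q kq] := k_surj (HndRing Hg); exists q.
have Hg' : Hnf X R g := Hg.1.
rewrite /rho_nf /= kq /=; apply: (@le_lt_trans _ _ (e / (1 + e))).
  by apply/(rhoP Hg' P (ltW e0)); exact: unif_closeC.
by rewrite ltr_pdivrMr ?ltr_pwDl ?(ltW e0)// mulrDr mulr1 ltrDl mulr_gt0.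
Qed.
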